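(* Let $\rho\in\big(\sqrt{|K^\times|}\big)^n$. Then every finite projective module over $K_{[\rho,\rho],n}$ is free.
   Context: Fix a prime $p$, a complete nonarchimedean field $K$ of mixed characteristic $(0,p)$ with norm $|\cdot|$, $|p|=p^{-1}$, and a positive integer $n$. $\sqrt{|K^\times|}\subset\mathbb{R}_{>0}$ is the divisible closure of $|K^\times|$. For $\rho=(\rho_1,\dots,\rho_n)\in\mathbb{R}_{>0}^n$, $K_{[\rho,\rho],n}$ is the ring of Laurent series $\sum_{i\in\mathbb{Z}^n}f_it^i$ ($f_i\in K$, $t^i=t_1^{i_1}\cdots t_n^{i_n}$) with $\lim_{|i|\to\infty}|f_i|\rho^i=0$, where $\rho^i=\rho_1^{i_1}\cdots\rho_n^{i_n}$ and $|i|=|i_1|+\cdots+|i_n|$. *)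

(* Defs.v *)
From HB Require Import structures.
From mathcomp Require Import all_boot all_order all_algebra.
From mathcomp Require Import interval_inference.
From mathcomp Require Import boolp classical_sets reals.
From mathcomp Require Import ring lra zify.

Set Implicit Arguments.
Unset Strict Implicit.
Unset Printing Implicit Defensive.

Import Order.TTheory GRing.Theory Num.Theory.
Local Open Scope ring_scope.

(* The norm takes values in a real field [R] distinct from [K], so MathComp's
   [normedZmodType] hierarchy, where the norm of a field is valued in that
   field, does not apply. *)
HB.mixin Record Field_isCompleteNonarch (R : realType) K of GRing.Field K := {
  absv : K -> R;
  absv_ge0 : forall x, 0 <= absv x;
  absv_eq0 : forall x, absv x = 0 <-> x = 0;
  absvM : forall x y, absv (x * y) = absv x * absv y;
  absvD : forall x y, absv (x + y) <= Num.max (absv x) (absv y);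
  absv_complete : forall x : nat -> K,
    (forall e, 0 < e -> exists N, forall i j, (N <= i)%N -> (N <= j)%N ->
       absv (x i - x j) < e) ->
    exists l, forall e, 0 < e -> exists N, forall i, (N <= i)%N ->
       absv (x i - l) < e
}.

#[short(type="completeNonarchFieldType")]
HB.structure Definition CompleteNonarchField (R : realType) :=
  {K of GRing.Field K & Field_isCompleteNonarch R K}.

(* The divisible closure of [|K^*|] inside the positive reals. *)
Definition sqrt_value_group (R : realType) (K : completeNonarchFieldType R)
    (r : R) : Prop :=
  0 < r /\ exists2 m : nat, (0 < m)%N &
    exists2 a : K, a != 0 & r ^+ m = absv a.

Section AbsTheory.
Context {R : realType} {K : completeNonarchFieldType R}.
Implicit Types (x y : K) (e : R).

Lemma absv0 : absv (0 : K) = 0.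
Proof. exact/absv_eq0. Qed.

Lemma absv1 : absv (1 : K) = 1.
Proof.
have nz : absv (1 : K) != 0.
  by apply/eqP => /absv_eq0 /eqP; rewrite oner_eq0.
by apply: (mulfI nz); rewrite -absvM !mulr1.
Qed.

Lemma absvN x : absv (- x) = absv x.
Proof.
have h : absv (- 1 : K) = 1.
  have : absv (- 1 : K) ^+ 2 = 1 by rewrite expr2 -absvM mulrNN mulr1 absv1.
  by move/eqP; rewrite sqrp_eq1 ?absv_ge0// => /eqP.
by rewrite -mulN1r absvM h mul1r.
Qed.

Lemma absv_distC x y : absv (x - y) = absv (y - x).
Proof. by rewrite -absvN opprB. Qed.

Lemma absvD_le x y e : absv x <= e -> absv y <= e -> absv (x + y) <= e.
Proof. by move=> hx hy; rewrite (le_trans (absvD x y))// ge_max hx. Qed.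

Lemma absvB_le x y e : absv x <= e -> absv y <= e -> absv (x - y) <= e.
Proof. by move=> hx hy; rewrite absvD_le ?absvN. Qed.

Lemma absvD_lt x y e : absv x < e -> absv y < e -> absv (x + y) < e.
Proof. by move=> hx hy; rewrite (le_lt_trans (absvD x y))// gt_max hx. Qed.

Lemma absv_sum (I : eqType) (s : seq I) (u : I -> K) e : 0 <= e ->
  (forall i, i \in s -> absv (u i) <= e) -> absv (\sum_(i <- s) u i) <= e.
Proof.
move=> e0 hu; rewrite big_seq; elim/big_ind: _ => //; first by rewrite absv0.
by move=> x y; apply: absvD_le.
Qed.

Lemma absv_le_eq x y : (forall e, 0 < e -> absv (x - y) <= e) -> x = y.
Proof.
move=> h; apply/eqP; rewrite -subr_eq0; apply/eqP/absv_eq0/le_anti.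
by rewrite absv_ge0 andbT; apply/ler_addgt0Pl => e /h; rewrite addr0.
Qed.

End AbsTheory.

Section Sums.
Context {R : realType} {K : completeNonarchFieldType R}.

(* [l] is the sum of the family [u], as a limit over the directed set of finite
   subsets of [I] (represented by duplicate-free sequences). *)
Definition hassum (I : choiceType) (u : I -> K) (l : K) : Prop :=
  forall e : R, 0 < e -> exists s : seq I, forall t : seq I,
    uniq t -> {subset s <= t} -> absv (\sum_(i <- t) u i - l) < e.

(* The value is meaningful only for families having a sum. *)
Definition infsum (I : choiceType) (u : I -> K) : K := xget 0 (hassum u).

Definition smalloff (I : choiceType) (u : I -> K) (s : seq I) (e : R) :=
  forall i, i \notin s -> absv (u i) <= e.

Definition nullfam (I : choiceType) (u : I -> K) :=
  forall e : R, 0 < e -> exists s, smalloff u s e.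

Lemma smalloff_sub (I : choiceType) (u : I -> K) s t e :
  {subset s <= t} -> smalloff u s e -> smalloff u t e.
Proof. by move=> st us i it; apply: us; apply: contra it => /st. Qed.

Lemma hassum_uniq (I : choiceType) (u : I -> K) l l' :
  hassum u l -> hassum u l' -> l = l'.
Proof.
move=> hl hl'; apply: absv_le_eq => e e0.
have [s hs] := hl e e0; have [s' hs'] := hl' e e0.
pose t := undup (s ++ s').
have ut : uniq t by apply: undup_uniq.
have /ltW h1 : absv (\sum_(i <- t) u i - l) < e.
  by apply: hs => // i is_; rewrite mem_undup mem_cat is_.
have /ltW h2 : absv (\sum_(i <- t) u i - l') < e.
  by apply: hs' => // i is_; rewrite mem_undup mem_cat is_ orbT.
have -> : l - l' = (\sum_(i <- t) u i - l') - (\sum_(i <- t) u i - l) by ring.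
exact: absvB_le.
Qed.

Lemma infsumE (I : choiceType) (u : I -> K) l : hassum u l -> infsum u = l.
Proof. by move=> h; apply: (hassum_uniq _ h); apply: xgetI h. Qed.

Lemma sum_tail (I : choiceType) (u : I -> K) s t e : 0 <= e ->
  uniq s -> uniq t -> smalloff u s e -> smalloff u t e ->
  absv (\sum_(i <- s) u i - \sum_(i <- t) u i) <= e.
Proof.
move=> e0 us ut hs ht.
rewrite (bigID (fun i => i \in t)) /= [X in _ - X](bigID (fun i => i \in s)) /=.
have -> : \sum_(i <- s | i \in t) u i = \sum_(i <- t | i \in s) u i.
  rewrite -big_filter -[RHS]big_filter; apply: perm_big.
  apply: uniq_perm; rewrite ?filter_uniq// => i.
  by rewrite !mem_filter andbC.
rewrite opprD addrACA subrr add0r absvB_le// -big_filter absv_sum// => i; rewrite mem_filter.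
  by case/andP => it _; apply: ht.
by case/andP => it _; apply: hs.
Qed.

Lemma nullfam_hassum (I : choiceType) (u : I -> K) :
  nullfam u -> exists l, hassum u l.
Proof.
move=> hu.
have inv0 N : 0 < (N.+1%:R^-1 : R) by rewrite invr_gt0 ltr0n.
have hN N : exists s, uniq s /\ smalloff u s N.+1%:R^-1.
  have [s hs] := hu _ (inv0 N); exists (undup s); split; first exact: undup_uniq.
  by apply: smalloff_sub hs => i; rewrite mem_undup.
have [s hs] := choice hN.
have inv_le N i : (N <= i)%N -> (i.+1%:R^-1 : R) <= N.+1%:R^-1.
  by move=> Ni; rewrite lef_pV2 ?posrE ?ltr0n// ler_nat.
have tail N i t : (N <= i)%N -> uniq t -> smalloff u t N.+1%:R^-1 ->
    absv (\sum_(j <- t) u j - \sum_(j <- s i) u j) <= N.+1%:R^-1.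
  move=> Ni ut ht; have [us si] := hs i.
  apply: sum_tail => //.
  by move=> j /si /le_trans; apply; apply: inv_le.
have arch e : 0 < e -> exists N, (N.+1%:R^-1 : R) < e.
  move=> e0; exists (Num.truncn e^-1).
  by rewrite -[ltRHS]invrK ltf_pV2 ?posrE ?invr_gt0 ?ltr0n// truncnS_gt.
have [e e0|l hl] := @absv_complete R K (fun N => \sum_(i <- s N) u i).
  have [N Ne] := arch e e0; exists N => i j Ni Nj.
  apply: le_lt_trans Ne; apply: tail => //; first by have [] := hs i.
  have [_ si] := hs i.
  by move=> k /si /le_trans; apply; apply: inv_le.
exists l => e e0; have [N Ne] := arch e e0; have [M hM] := hl e e0.
exists (s N) => t ut st.
rewrite -(subrKA (\sum_(i <- s (maxn N M)) u i)) absvD_lt//.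
  apply: le_lt_trans Ne; apply: tail => //; first exact: leq_maxl.
  by apply: smalloff_sub st _; have [] := hs N.
by apply: hM; apply: leq_maxr.
Qed.

Lemma infsumP (I : choiceType) (u : I -> K) :
  nullfam u -> hassum u (infsum u).
Proof. by case/nullfam_hassum => l hl; rewrite (infsumE hl). Qed.

Lemma hassum_tail (I : choiceType) (u : I -> K) l s e : 0 < e -> uniq s ->
  hassum u l -> smalloff u s e -> absv (\sum_(i <- s) u i - l) <= e.
Proof.
move=> e0 us hl hs; have [s' hs'] := hl e e0.
pose t := undup (s ++ s').
have ut : uniq t by apply: undup_uniq.
rewrite -(subrKA (\sum_(i <- t) u i)) absvD_le//; last first.
  by apply/ltW/hs' => // i i_; rewrite mem_undup mem_cat i_ orbT.
apply: sum_tail => //; first exact: ltW.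
by apply: smalloff_sub hs => i i_; rewrite mem_undup mem_cat i_.
Qed.

Lemma hassum_le (I : choiceType) (u : I -> K) l e : 0 < e ->
  hassum u l -> (forall i, absv (u i) <= e) -> absv l <= e.
Proof.
move=> e0 hl hu; have := @hassum_tail _ u l [::] e e0 isT hl (fun i _ => hu i).
by rewrite big_nil sub0r absvN.
Qed.

Lemma hassum_intro (I : choiceType) (u : I -> K) l :
  (forall e, 0 < e -> exists s, [/\ uniq s, smalloff u s e &
     absv (\sum_(i <- s) u i - l) <= e]) -> hassum u l.
Proof.
move=> h.
have [|l' hl'] := @nullfam_hassum _ u.
  by move=> e /h[s [_ hs _]]; exists s.
suff -> : l = l' by [].
apply: absv_le_eq => e e0; have [s [us hs sl]] := h e e0.
rewrite -(subrKA (\sum_(i <- s) u i)) absvD_le 1?absv_distC//.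
by rewrite absv_distC; apply: hassum_tail.
Qed.

Lemma hassum_fubini (I J : choiceType) (u : I * J -> K) l (v : I -> K) :
  nullfam u -> hassum u l -> (forall i, hassum (fun j => u (i, j)) (v i)) ->
  hassum v l.
Proof.
move=> nu hu hv; apply: hassum_intro => e e0.
have [s hs] := nu e e0.
pose s1 := undup (map fst s); pose s2 := undup (map snd s).
have u1 : uniq s1 by apply: undup_uniq.
have u2 : uniq s2 by apply: undup_uniq.
exists s1; split => //.
  move=> i is1; apply: (hassum_le e0 (hv i)) => j; apply: hs.
  apply: contra is1 => ijs; rewrite mem_undup.
  by apply/mapP; exists (i, j).
pose t := [seq (i, j) | i <- s1, j <- s2].
have ht : smalloff u t e.
  apply: smalloff_sub hs => -[i j] ijs; apply/allpairsP; exists (i, j).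
  by rewrite !mem_undup; split=> //; apply/mapP; exists (i, j).
rewrite -(subrKA (\sum_(i <- t) u i)) absvD_le//; last first.
  apply: hassum_tail => //.
  by apply: allpairs_uniq => // -[? ?] [? ?] _ _.
rewrite big_allpairs -sumrB absv_sum ?ltW// => i _.
rewrite absv_distC; apply: hassum_tail => // j js2; apply: hs.
by apply: contra js2 => ijs; rewrite mem_undup; apply/mapP; exists (i, j).
Qed.

Lemma hassum_reindex (I J : choiceType) (u : I -> K) l (phi : J -> I)
    (psi : I -> J) : cancel phi psi -> cancel psi phi ->
  hassum u l -> hassum (u \o phi) l.
Proof.
move=> phiK psiK hu e e0; have [s hs] := hu e e0.
exists (map psi s) => t ut st; rewrite -(big_map phi xpredT u) hs//.
  by rewrite map_inj_uniq//; apply: can_inj phiK.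
move=> i is_; apply/mapP; exists (psi i); last by rewrite psiK.
by apply: st; apply: map_f.
Qed.

Lemma hassumD (I : choiceType) (u v : I -> K) l m :
  hassum u l -> hassum v m -> hassum (fun i => u i + v i) (l + m).
Proof.
move=> hu hv e e0; have [s hs] := hu e e0; have [s' hs'] := hv e e0.
exists (s ++ s') => t ut st.
have -> : \sum_(i <- t) (u i + v i) - (l + m) =
    (\sum_(i <- t) u i - l) + (\sum_(i <- t) v i - m).
  by rewrite big_split /=; ring.
rewrite absvD_lt// ?hs ?hs'// => i i_; apply: st; rewrite mem_cat i_ ?orbT//.
Qed.

Lemma hassumZ (I : choiceType) (u : I -> K) l c :
  hassum u l -> hassum (fun i => c * u i) (c * l).
Proof.
move=> hu e e0; have [->|c0] := eqVneq c 0.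
  exists [::] => t _ _; rewrite mul0r subr0 big1 ?absv0// => i _.
  by rewrite mul0r.
have ac : 0 < absv c.
  by rewrite lt_def absv_ge0 andbT; apply: contra c0 => /eqP/absv_eq0/eqP.
have [|s hs] := hu (e / absv c); first by rewrite divr_gt0.
exists s => t ut st; rewrite -mulr_sumr -mulrBr absvM mulrC -ltr_pdivlMr//.
exact: hs.
Qed.

Lemma hassumZr (I : choiceType) (u : I -> K) l c :
  hassum u l -> hassum (fun i => u i * c) (l * c).
Proof.
rewrite mulrC; have -> : (fun i => u i * c) = (fun i => c * u i).
  by apply/funext => i; rewrite mulrC.
exact: hassumZ.
Qed.

Lemma hassum1 (I : choiceType) (u : I -> K) i0 :
  (forall i, i != i0 -> u i = 0) -> hassum u (u i0).
Proof.
move=> hu; apply: hassum_intro => e e0; exists [:: i0]; split => //.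
  by move=> i; rewrite inE => /hu ->; rewrite absv0 ltW.
by rewrite big_seq1 subrr absv0 ltW.
Qed.

End Sums.

Notation multiexp n := {ffun 'I_n -> int}.

Section Laurent.
Context {R : realType} {K : completeNonarchFieldType R} {n : nat}.
Variable rho : 'I_n -> {posnum R}.
Implicit Types (i j k : multiexp n).

Definition rpow i : R := \prod_(k < n) (rho k)%:num ^ i k.

Definition mnorm i : nat := (\sum_(k < n) `|i k|)%N.

Definition null_coef (f : multiexp n -> K) : Prop :=
  forall e : R, 0 < e -> exists N : nat, forall i, (N < mnorm i)%N ->
    absv (f i) * rpow i < e.

(* The ring [K_{[rho,rho],n}]: the series [\sum_i f_i t^i] is represented by
   its coefficient family. *)
Record laurent := Laurent {
  coef :> multiexp n -> K;
  coefP : null_coef coef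
}.

Lemma laurent_eq (f g : laurent) : (forall i, f i = g i) -> f = g.
Proof.
case: f g => f hf [g hg] /= /funext fg; move: hf hg; rewrite fg => hf hg.
by congr Laurent; apply: Prop_irrelevance.
Qed.

HB.instance Definition _ := gen_eqMixin laurent.
HB.instance Definition _ := gen_choiceMixin laurent.

Lemma rpow_gt0 i : 0 < rpow i.
Proof. by apply: prodr_gt0 => k _; apply: exprz_gt0. Qed.

Lemma rpowD i j : rpow (i + j) = rpow i * rpow j.
Proof.
rewrite /rpow -big_split /=; apply: eq_bigr => k _.
by rewrite ffunE expfzDr.
Qed.

Lemma mnorm_finite (N : nat) :
  exists s : seq (multiexp n), forall i, (mnorm i <= N)%N -> i \in s.
Proof.
exists [seq [ffun k : 'I_n => (g k : nat)%:Z - N%:Z] | g : {ffun 'I_n -> 'I_(N + N).+1}].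
move=> i iN.
have hk (k : 'I_n) : (absz (i k + N%:Z)%R < (N + N).+1)%N /\ 0 <= i k + N%:Z.
  have : (`|i k| <= N)%N.
    by apply: leq_trans iN; rewrite /mnorm (bigD1 k)//= leq_addr.
  by lia.
apply/mapP; exists [ffun k : 'I_n => Ordinal (hk k).1]; first by rewrite mem_enum.
by apply/ffunP => k; rewrite !ffunE /=; have [_] := hk k; lia.
Qed.

Lemma null_coefP (f : multiexp n -> K) :
  null_coef f <-> forall e : R, 0 < e -> exists s : seq (multiexp n),
    forall i, i \notin s -> absv (f i) * rpow i <= e.
Proof.
split=> h e e0.
  have [N hN] := h e e0; have [s hs] := mnorm_finite N; exists s => i is_.
  by apply/ltW/hN; rewrite ltnNge; apply: contra is_; apply: hs.
have e20 : 0 < e / 2 by rewrite divr_gt0.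
have [s hs] := h _ e20; exists (\max_(i <- s) mnorm i)%N => i hi.
have: absv (f i) * rpow i <= e / 2.
  apply: hs; apply/negP => is_; move: hi; rewrite ltnNge => /negP; apply.
  exact: leq_bigmax_seq.
by move=> /le_lt_trans; apply; rewrite ltr_pdivrMr// mulr_natr mulr2n ltrDl.
Qed.

Lemma laurent_bound (f : laurent) :
  exists2 M, 0 < M & forall i, absv (f i) * rpow i <= M.
Proof.
have [s hs] := (null_coefP f).1 (coefP f) 1 ltr01.
exists (1 + \sum_(i <- s) absv (f i) * rpow i).
  rewrite ltr_pwDl// sumr_ge0// => i _.
  by rewrite mulr_ge0 ?absv_ge0// ltW// rpow_gt0.
have ge0 i : 0 <= absv (f i) * rpow i.
  by rewrite mulr_ge0 ?absv_ge0// ltW// rpow_gt0.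
move=> i; have [is_|/hs hi] := boolP (i \in s).
  by rewrite (big_rem i)//= addrCA lerDl addr_ge0// sumr_ge0.
by rewrite (le_trans hi)// lerDl sumr_ge0.
Qed.

Lemma null_coef0 : null_coef (fun=> 0).
Proof. by move=> e e0; exists 0%N => i _; rewrite absv0 mul0r. Qed.

Lemma null_coefN (f : laurent) : null_coef (fun i => - f i).
Proof.
move=> e /(coefP f)[N hN]; exists N => i /hN; by rewrite absvN.
Qed.

Lemma null_coefD (f g : laurent) : null_coef (fun i => f i + g i).
Proof.
move=> e e0; have [N hN] := coefP f e0; have [M hM] := coefP g e0.
exists (maxn N M) => i; rewrite gtn_max => /andP[/hN fe /hM ge].
rewrite -ltr_pdivlMr ?rpow_gt0//; apply: absvD_lt;
  by rewrite ltr_pdivlMr ?rpow_gt0.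
Qed.

Lemma null_coef_delta : null_coef (fun i => (i == 0)%:R).
Proof.
move=> e e0; exists 0%N => i hi.
have /negPf -> : i != 0.
  apply: contraL hi => /eqP ->; rewrite -leqNgt leqn0; apply/eqP.
  by rewrite /mnorm big1// => k _; rewrite ffunE.
by rewrite absv0 mul0r.
Qed.

Lemma conv_smalloff (f g : laurent) (e : R) : 0 < e ->
  exists s t : seq (multiexp n), forall i j,
    (i \in s) && (j \in t) \/
    absv (f i * g j) * rpow (i + j) <= e.
Proof.
move=> e0; have [M M0 hM] := laurent_bound f.
have [M' M'0 hM'] := laurent_bound g.
have [|s hs] := (null_coefP f).1 (coefP f) (e / M'); first by rewrite divr_gt0.
have [|t ht] := (null_coefP g).1 (coefP g) (e / M); first by rewrite divr_gt0.
have w0 (h : laurent) i : 0 <= absv (h i) * rpow i.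
  by rewrite mulr_ge0 ?absv_ge0// ltW// rpow_gt0.
exists s, t => i j; rewrite absvM rpowD mulrACA.
have [is_|/hs hi] /= := boolP (i \in s); last first.
  by right; rewrite -(divfK (lt0r_neq0 M'0) e) ler_pM.
have [|/ht hj] := boolP (j \in t); first by left.
right; rewrite -(divfK (lt0r_neq0 M0) e) mulrC ler_pM//.
Qed.

Lemma conv_nullfam (f g : laurent) k : nullfam (fun i => f i * g (k - i)).
Proof.
move=> e e0; have [|s [t st]] := @conv_smalloff f g (e * rpow k).
  by rewrite mulr_gt0// rpow_gt0.
exists s => i is_; case: (st i (k - i)); first by rewrite (negPf is_).
by rewrite subrKC ler_pM2r// rpow_gt0.
Qed.

Definition conv (f g : laurent) k : K := infsum (fun i => f i * g (k - i)).

Lemma null_conv (f g : laurent) : null_coef (conv f g).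
Proof.
apply/null_coefP => e e0; have [s [t st]] := conv_smalloff f g e0.
exists [seq i + j | i <- s, j <- t] => k hk.
rewrite -ler_pdivlMr ?rpow_gt0//.
apply: (hassum_le _ (infsumP (conv_nullfam f g k))).
  by rewrite divr_gt0// rpow_gt0.
move=> i; rewrite ler_pdivlMr ?rpow_gt0//.
case: (st i (k - i)); last by rewrite subrKC.
move=> /andP[is_ kt]; case/negP: hk; apply/allpairsP; exists (i, k - i).
by split=> //=; rewrite subrKC.
Qed.

Definition laurent0 := Laurent null_coef0.
Definition laurentN (f : laurent) := Laurent (null_coefN f).
Definition laurentD (f g : laurent) := Laurent (null_coefD f g).
Definition laurent1 := Laurent null_coef_delta.
Definition laurentM (f g : laurent) := Laurent (null_conv f g).

Lemma laurent_addA : associative laurentD.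
Proof. by move=> f g h; apply: laurent_eq => i /=; rewrite addrA. Qed.
Lemma laurent_addC : commutative laurentD.
Proof. by move=> f g; apply: laurent_eq => i /=; rewrite addrC. Qed.
Lemma laurent_add0 : left_id laurent0 laurentD.
Proof. by move=> f; apply: laurent_eq => i /=; rewrite add0r. Qed.
Lemma laurent_addN : left_inverse laurent0 laurentN laurentD.
Proof. by move=> f; apply: laurent_eq => i /=; rewrite addNr. Qed.

HB.instance Definition _ := GRing.isZmodule.Build laurent
  laurent_addA laurent_addC laurent_add0 laurent_addN.

Lemma laurent_mulC : commutative laurentM.
Proof.
move=> f g; apply: laurent_eq => k /=; apply: infsumE.
have := infsumP (conv_nullfam g f k).
move=> /(@hassum_reindex R K _ _ _ _ (fun i => k - i) (fun i => k - i)).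
rewrite -/(conv g f k); have -> : ((fun i => g i * f (k - i)) \o
    (fun i => k - i)) = (fun i => f i * g (k - i)).
  by apply/funext => i /=; rewrite subKr mulrC.
by apply => i; rewrite subKr.
Qed.

Lemma laurent_mul1 : left_id laurent1 laurentM.
Proof.
move=> f; apply: laurent_eq => k /=; apply: infsumE.
have := @hassum1 R K _ (fun i => (i == 0)%:R * f (k - i)) 0.
by rewrite eqxx mul1r subr0; apply => i /negPf ->; rewrite mul0r.
Qed.

Lemma laurent_mulDl : left_distributive laurentM laurentD.
Proof.
move=> f g h; apply: laurent_eq => k /=; apply: infsumE.
have := hassumD (infsumP (conv_nullfam f h k)) (infsumP (conv_nullfam g h k)).
by under eq_fun do rewrite -mulrDl.
Qed.

Lemma conv3_nullfam (f g h : laurent) k :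
  nullfam (fun ij : multiexp n * multiexp n =>
    f ij.1 * g ij.2 * h (k - (ij.1 + ij.2))).
Proof.
move=> e e0; have [M M0 hM] := laurent_bound h.
have [|s [t st]] := @conv_smalloff f g (e * rpow k / M).
  by rewrite divr_gt0// mulr_gt0// rpow_gt0.
exists [seq (i, j) | i <- s, j <- t] => -[i j] /= ijs.
case: (st i j) => [/andP[is_ jt]|hij].
  by case/negP: ijs; apply/allpairsP; exists (i, j).
rewrite -(ler_pM2r (rpow_gt0 k)).
have {1}-> : rpow k = rpow (i + j) * rpow (k - (i + j)) by rewrite -rpowD subrKC.
rewrite absvM mulrACA -[leRHS](divfK (lt0r_neq0 M0)).
by rewrite ler_pM// mulr_ge0 ?absv_ge0// ltW// rpow_gt0.
Qed.

Lemma laurent_mulA : associative laurentM.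
Proof.
move=> f g h; apply: laurent_eq => k /=.
have nul := conv3_nullfam f g h k.
have sum := infsumP nul; set u := (X in hassum X _) in sum.
have e1 : conv f (laurentM g h) k = infsum u.
  apply/infsumE/(hassum_fubini nul sum) => i.
  have := hassumZ (f i) (infsumP (conv_nullfam g h (k - i))).
  have -> : (fun j => f i * (g j * h (k - i - j))) = (fun j => u (i, j)).
    by apply/funext => j; rewrite /u /= mulrA opprD addrA.
  exact.
rewrite e1; symmetry; apply: infsumE.
pose phi (ji : multiexp n * multiexp n) := (ji.2, ji.1 - ji.2).
pose psi (ij : multiexp n * multiexp n) := (ij.1 + ij.2, ij.1).
have phiK : cancel phi psi.
  by move=> -[j i]; rewrite /phi /psi /= subrKC.
have psiK : cancel psi phi.
  by move=> -[i j]; rewrite /phi /psi /= addrC addKr.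
have nul' : nullfam (u \o phi).
  move=> e e0; have [s hs] := nul e e0; exists (map psi s) => ji hji.
  apply: hs; apply: contra hji => hji.
  by rewrite -[ji]phiK map_f.
apply: (hassum_fubini nul' (hassum_reindex phiK psiK sum)) => j.
have := hassumZr (h (k - j)) (infsumP (conv_nullfam f g j)).
have -> : (fun i => f i * g (j - i) * h (k - j)) =
    (fun i => (u \o phi) (j, i)).
  by apply/funext => i; rewrite /u /= subrKC.
exact.
Qed.

Lemma laurent_1neq0 : laurent1 != 0.
Proof.
apply/eqP => /(congr1 (fun f : laurent => f 0)) /= /eqP.
by rewrite eqxx oner_eq0.
Qed.

HB.instance Definition _ := GRing.Zmodule_isComNzRing.Build laurent
  laurent_mulA laurent_mulC laurent_mul1 laurent_mulDl laurent_1neq0.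

Lemma coef_mul (f g : laurent) k :
  hassum (fun i => f i * g (k - i)) ((f * g) k).
Proof. exact: infsumP (conv_nullfam f g k). Qed.

End Laurent.

Arguments laurent {R} K {n} rho.

Section Modules.
Context {A : comNzRingType}.
Implicit Types P : lmodType A.

Definition finite_module P : Prop :=
  exists (d : nat) (e : 'I_d -> P), forall x : P,
    exists c : 'I_d -> A, x = \sum_(k < d) c k *: e k.

Definition projective_module P : Prop :=
  forall (M N : lmodType A) (g : {linear M -> N}) (f : {linear P -> N}),
    (forall y, exists x, g x = y) ->
    exists h : {linear P -> M}, forall x, g (h x) = f x.

Definition basis_family P (I : Type) (e : I -> P) : Prop :=
  (forall x : P, exists (d : nat) (i : 'I_d -> I) (c : 'I_d -> A),
     x = \sum_(k < d) c k *: e (i k)) /\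
  (forall (d : nat) (i : 'I_d -> I) (c : 'I_d -> A), injective i ->
     \sum_(k < d) c k *: e (i k) = 0 -> forall k, c k = 0).

Definition free_module P : Prop :=
  exists (I : Type) (e : I -> P), basis_family e.

End Modules.

(* Main.v *)
Require Import Defs.
From HB Require Import structures.
From mathcomp Require Import all_boot all_order all_algebra.
From mathcomp Require Import ring_quotient fraction generic_quotient perm.
From mathcomp Require Import interval_inference.
From mathcomp Require Import boolp classical_sets reals.
From mathcomp Require Import ring lra zify.

Set Implicit Arguments.
Unset Strict Implicit.
Unset Printing Implicit Defensive.

Import Order.TTheory GRing.Theory Num.Theory.
Local Open Scope ring_scope.

(** Let A be the ring of Laurent series in n + 1 variables. Freeness of its finite
    projective modules is proved by induction on the number of variables, for all
    radii at once, along the lines of the theorem of Quillen and Suslin, with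
    convergent series in the place of polynomials.

    The analytic part is Weierstrass preparation ([laurent_preparable]). A nonzero
    f in A has finitely many terms of maximal norm. After a monomial change of
    variables a single one of them has the largest degree, and a single one the
    least degree, in a distinguished variable t. Long division by f from both
    ends, repeated on the error terms, then shows that f is a unit times w(t),
    where w is a monic polynomial over the ring B of Laurent series in the n other
    variables, and that w(t) admits division with unique remainder in A. Thus
    A/w(t) = B[X]/w is free of finite rank over B, and by induction finite
    projective modules over B are free.

    The rest is algebra ([weierstrass_projfree]). Let P be finite projective, the
    image of an idempotent matrix. Over the fraction field it is free, so P embeds
    in some A^r with an image containing f A^r, and f may be taken to be w(t).
    The quotient Q = A^r/P is finite over B. Weierstrass division provides a
    B-linear retraction of A^r onto P, so Q is projective over B, hence
    isomorphic to B^m, and t acts on it by a matrix phi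
    ([weierstrass_quotient_free]). Comparing the resolution of Q by A^r and P
    with the one given by t - phi on A^m shows that P is stably free
    ([weierstrass_stably_free]).

    It remains to see that the kernel of a unimodular row over A is free. One
    entry can be made equal to w(t) and the others reduced to polynomials in t
    modulo it; the row so obtained is unimodular over B[X] and has a monic entry
    ([splits_off_weierstrass]). By Suslin's theorem ([suslin_row_equiv]) it is
    equivalent to its value at X = 0, a unimodular row over B, whose kernel is free
    by induction. *)

(** * Fields attached to a commutative ring *)

Section FieldOfUnits.
Variables (Q : comNzRingType) (Qinv : forall x : Q, x != 0 -> exists y, y * x = 1).

(** The body mentions [Qinv] so that the type, and the field structure put on
    it, depend on the existence of inverses. *)
Definition field_of_units : Type := let _ := Qinv in Q.
HB.instance Definition _ := GRing.ComNzRing.on field_of_units.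

Let fou_inv (x : field_of_units) : field_of_units :=
  if x == 0 then 0 else xget 0 (fun y => y * x = 1).

Let fou_mulV x : x != 0 -> fou_inv x * x = 1.
Proof.
move=> x0; rewrite /fou_inv (negPf x0).
by have [y yx] := Qinv x0; apply: (@xgetI _ 0 (fun y => y * x = 1) y yx).
Qed.

Let fou_inv0 : fou_inv 0 = 0.
Proof. by rewrite /fou_inv eqxx. Qed.

HB.instance Definition _ :=
  GRing.ComNzRing_isField.Build field_of_units fou_mulV fou_inv0.

Definition to_field_of_units (x : Q) : field_of_units := x.
Let tofou_add : zmod_morphism to_field_of_units.
Proof. by []. Qed.
Let tofou_mul : monoid_morphism to_field_of_units.
Proof. by []. Qed.
HB.instance Definition _ :=
  GRing.isZmodMorphism.Build Q field_of_units to_field_of_units tofou_add.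
HB.instance Definition _ :=
  GRing.isMonoidMorphism.Build Q field_of_units to_field_of_units tofou_mul.
End FieldOfUnits.

Section Domain.
Variables (Q : comNzRingType)
  (Qint : forall x y : Q, x * y = 0 -> (x == 0) || (y == 0)).

(** As for [field_of_units], the body only makes the type depend on [Qint]. *)
Definition domain_of : Type := let _ := Qint in Q.
HB.instance Definition _ := GRing.ComNzRing.on domain_of.

Let dunit : pred domain_of := fun x => `[< exists y, y * x = 1 >].
Let dinv (x : domain_of) : domain_of := xget x (fun y => y * x = 1).

Let dmulV : {in dunit, left_inverse 1 dinv *%R}.
Proof.
move=> x /asboolP [y yx]; exact: (@xgetI _ x (fun y => y * x = 1) y yx).
Qed.

Let dunitP x y : y * x = 1 -> dunit x.
Proof. by move=> yx; apply/asboolP; exists y. Qed.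

Let dinv_out : {in [predC dunit], dinv =1 id}.
Proof.
move=> x; rewrite inE /= => /asboolP xn; apply: xgetPN => y yx.
by apply: xn; exists y.
Qed.

HB.instance Definition _ :=
  GRing.ComNzRing_hasMulInverse.Build domain_of dmulV dunitP dinv_out.
HB.instance Definition _ :=
  GRing.ComUnitRing_isIntegral.Build domain_of Qint.

Definition to_domain (x : Q) : domain_of := x.
Let todom_add : zmod_morphism to_domain.
Proof. by []. Qed.
Let todom_mul : monoid_morphism to_domain.
Proof. by []. Qed.
HB.instance Definition _ :=
  GRing.isZmodMorphism.Build Q domain_of to_domain todom_add.
HB.instance Definition _ :=
  GRing.isMonoidMorphism.Build Q domain_of to_domain todom_mul.
End Domain.

Lemma fraction_field (Q : comNzRingType) :
  (forall x y : Q, x * y = 0 -> (x == 0) || (y == 0)) ->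
  exists (L : fieldType) (j : {rmorphism Q -> L}), injective j /\
    forall z : L, exists2 b, b != 0 & exists a, z * j b = j a.
Proof.
move=> Qint.
exists {fraction (domain_of Qint)}.
exists ((@tofrac (domain_of Qint) : {rmorphism _ -> _}) \o
  (to_domain Qint : {rmorphism _ -> _}))%FUN.
split=> [x y /= /eqP|z].
  by rewrite tofrac_eq => /eqP.
elim/(@quotW (ratio (domain_of Qint))): z => x.
exists (\d_x); first exact: denom_ratioP.
exists (\n_x) => /=; rewrite /to_domain; unlock FracField.tofrac.
rewrite -[LHS]FracField.pi_mul; apply/eqmodP => /=.
rewrite /FracField.equivf /FracField.mulf /=.
by rewrite !numden_Ratio ?(oner_neq0, mulr1, mulf_neq0, denom_ratioP)// mulrC.
Qed.

Section Ideals.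
Local Open Scope classical_set_scope.
Variable B : comNzRingType.

Definition is_ideal (I : set B) :=
  I 0 /\ forall a x y, I x -> I y -> I (a * x + y).

(** A field where [I] vanishes is the quotient by a maximal ideal containing
    [I]; it turns a question about the ideal [I] into one about polynomials over
    a field. *)
Lemma field_killing_ideal (I : set B) : is_ideal I -> ~ I 1 ->
  exists (F : fieldType) (phi : {rmorphism B -> F}),
    (forall x, I x -> phi x = 0) /\ forall z, exists x, phi x = z.
Proof.
move=> idI nI1.
(* The empty set is admitted because Zorn's lemma asks for the union of every
   chain, the empty one included. *)
pose P (J : set B) := J = set0 \/ [/\ is_ideal J, I `<=` J & ~ J 1].
have [|M [PM Mmax]] := @Zorn_bigcup _ P.
  move=> F FP Ftot.
  have [[J0 [FJ0 [x0 J0x0]]]|nF] := pselect (exists J, F J /\ exists x, J x);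
    last first.
    left; rewrite -subset0 => x [J FJ Jx]; apply: nF.
    by exists J; split => //; exists x.
  have FP' J x : F J -> J x -> [/\ is_ideal J, I `<=` J & ~ J 1].
    by move=> FJ Jx; case: (FP _ FJ) => // J0'; move: Jx; rewrite J0'.
  have [id0 I0 ?] := FP' _ _ FJ0 J0x0.
  right; split.
  - split; first by exists J0 => //; case: id0.
    move=> a x y [J FJ Jx] [J' FJ' Jy].
    have [[_ idJ] _ _] := FP' _ _ FJ Jx; have [[_ idJ'] _ _] := FP' _ _ FJ' Jy.
    case: (Ftot _ _ FJ FJ') => sub.
      by exists J' => //; apply: idJ' => //; apply: sub.
    by exists J => //; apply: idJ => //; apply: sub.
  - by move=> x Ix; exists J0 => //; apply: I0.
  - by case=> J FJ J1; have [] := FP' _ _ FJ J1.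
have {PM}[idM IM nM1] : [/\ is_ideal M, I `<=` M & ~ M 1].
  case: PM => // M0; exfalso; apply: (Mmax I); last by right; split.
  rewrite M0; split; first by move=> x [].
  by move/(_ 0 idI.1).
have Munit x : ~ M x -> exists y, M (y * x - 1).
  move=> nMx.
  pose J : set B := fun z => exists a, M (z - a * x).
  have idJ : is_ideal J.
    split; first by exists 0; rewrite mul0r subr0; case: idM.
    move=> a y z [b Mb] [c Mc]; exists (a * b + c).
    have -> : a * y + z - (a * b + c) * x = a * (y - b * x) + (z - c * x) by ring.
    exact: idM.2.
  have [[a Ma]|nJ1] := pselect (J 1).
    exists a; have -> : a * x - 1 = (-1) * (1 - a * x) + 0 by ring.
    by apply: idM.2 => //; case: idM.
  exfalso; apply: (Mmax J); last first.
    right; split => // y Iy; exists 0; rewrite mul0r subr0; exact: IM.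
  split; first by move=> y My; exists 0; rewrite mul0r subr0.
  move/(_ x) => h; apply: nMx; apply: h; exists 1; rewrite mul1r subrr.
  by case: idM.
pose Mp : {pred B} := fun x => `[< M x >].
have idMp : idealr_closed Mp.
  split; first by apply/asboolP; case: idM.
    by apply/negP => /asboolP.
  by move=> a x y /asboolP Mx /asboolP My; apply/asboolP/idM.2.
pose mI := isIdealr.Build B Mp idMp.
pose MI : idealr B := HB.pack Mp mI.
pose Q : comNzRingType := {ideal_quot MI}.
have prE (x : B) : (\pi_Q x = 0)%qT <-> M x.
  split.
    move=> /eqP; rewrite -(rmorph0 (\pi_Q%qT : {rmorphism B -> Q})) /=.
    by rewrite -Quotient.idealrBE subr0 => /asboolP.
  move=> Mx; apply/eqP; rewrite -(rmorph0 (\pi_Q%qT : {rmorphism B -> Q})) /=.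
  by rewrite -Quotient.idealrBE subr0; apply/asboolP.
have Qinv (z : Q) : z != 0 -> exists y, y * z = 1.
  elim/quotW: z => x /eqP x0.
  have [y My] : exists y, M (y * x - 1) by apply: Munit => /prE.
  exists (\pi_Q y)%qT.
  apply/eqP; rewrite -subr_eq0; apply/eqP.
  rewrite -(rmorph1 (\pi_Q%qT : {rmorphism B -> Q})) -rmorphM -rmorphB /=.
  exact/prE.
exists (field_of_units Qinv).
exists ((to_field_of_units Qinv : {rmorphism _ -> _}) \o
  (\pi_Q%qT : {rmorphism B -> Q}))%FUN.
split=> [x Ix|]; first by apply/prE/IM.
by elim/(@quotW B Q) => x; exists x.
Qed.
End Ideals.

(** * Suslin's theorem on unimodular rows *)

Section RowEquiv.
Variable S : comNzRingType.

Definition row_equiv m (f f' : 'rV[S]_m) : Prop :=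
  exists M N : 'M[S]_m, M *m N = 1%:M /\ f' = f *m M.

Lemma row_equiv_refl m (f : 'rV[S]_m) : row_equiv f f.
Proof. by exists 1%:M, 1%:M; rewrite !mulmx1. Qed.

Lemma row_equiv_sym m (f f' : 'rV[S]_m) : row_equiv f f' -> row_equiv f' f.
Proof.
move=> [M [N [MN ->]]]; exists N, M; split; first exact: mulmx1C.
by rewrite -mulmxA MN mulmx1.
Qed.

Lemma row_equiv_trans m (f2 f1 f3 : 'rV[S]_m) :
  row_equiv f1 f2 -> row_equiv f2 f3 -> row_equiv f1 f3.
Proof.
move=> [M [N [MN ->]]] [M' [N' [MN' ->]]]; exists (M *m M'), (N' *m N).
by rewrite mulmxA -(mulmxA M) MN' mulmx1 MN mulmxA.
Qed.

Lemma row_equiv_addr m1 m2 (u : 'rV[S]_m1) (v : 'rV[S]_m2) H :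
  row_equiv (row_mx u v) (row_mx u (v + u *m H)).
Proof.
exists (block_mx 1%:M H 0 1%:M), (block_mx 1%:M (- H) 0 1%:M); split.
  by rewrite mulmx_block !(mulmx0, mul0mx, mulmx1, mul1mx, addr0, add0r) addNr
    -scalar_mx_block.
by rewrite mul_row_block !(mulmx0, mulmx1, addr0) addrC.
Qed.

Lemma row_equiv_addl m1 m2 (u : 'rV[S]_m1) (v : 'rV[S]_m2) L :
  row_equiv (row_mx u v) (row_mx (u + v *m L) v).
Proof.
exists (block_mx 1%:M 0 L 1%:M), (block_mx 1%:M 0 (- L) 1%:M); split.
  by rewrite mulmx_block !(mulmx0, mul0mx, mulmx1, mul1mx, addr0, add0r) subrr
    -scalar_mx_block.
by rewrite mul_row_block !(mulmx0, mulmx1, add0r).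
Qed.

Lemma row_equiv_diagl m1 m2 (u : 'rV[S]_m1) (v : 'rV[S]_m2) M N :
  M *m N = 1%:M -> row_equiv (row_mx u v) (row_mx (u *m M) v).
Proof.
move=> MN; exists (block_mx M 0 0 1%:M), (block_mx N 0 0 1%:M); split.
  by rewrite mulmx_block !(mulmx0, mul0mx, mulmx1, mul1mx, addr0, add0r) MN
    -scalar_mx_block.
by rewrite mul_row_block !(mulmx0, mulmx1, add0r, addr0).
Qed.

(** Put N = (F, -Q; G, P), of determinant c, and N' for its analogue made from
    the shifted entries. Then N' N^-1 carries (F, G) to the shifted pair and has
    determinant 1; since N' and N agree modulo c, the entries of N' adj(N) are
    divisible by c, so the quotient has entries in [S]. The remaining entries of
    the row may then move by multiples of c, which lies in the ideal of the
    first two. *)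
Lemma row_equiv_pair m (F G f g P Q p q c : S) (v h : 'rV[S]_m) :
  (forall x, c * x = 0 -> x = 0) ->
  P * F + Q * G = c -> (P + c * p) * (F + c * f) + (Q + c * q) * (G + c * g) = c ->
  row_equiv (row_mx (row_mx F%:M G%:M) v)
    (row_mx (row_mx (F + c * f)%:M (G + c * g)%:M : 'rV_(1 + 1)) (v + c *: h)).
Proof.
move=> creg cPQ cPQ'.
have Eg : p * F + P * f + q * G + Q * g + c * (p * f + q * g) = 0.
  apply: creg.
  transitivity ((P + c * p) * (F + c * f) + (Q + c * q) * (G + c * g) -
    (P * F + Q * G)); first by ring.
  by rewrite cPQ cPQ' subrr.
(* The transpose of N' adj(N) / c, written without division. *)
pose a11 := 1 + f * P + q * G; pose a12 := g * P - p * G.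
pose a21 := f * Q - q * F; pose a22 := 1 + g * Q + p * F.
have det1 : a11 * a22 - a12 * a21 = 1.
  rewrite -[RHS]addr0 -Eg -cPQ /a11 /a12 /a21 /a22; ring.
pose M : 'M[S]_(1 + 1) := block_mx a11%:M a12%:M a21%:M a22%:M.
pose N : 'M[S]_(1 + 1) := block_mx a22%:M (- a12)%:M (- a21)%:M a11%:M.
have MN : M *m N = 1%:M.
  rewrite mulmx_block -!scalar_mxM -!raddfD /= [RHS]scalar_mx_block.
  have -> : a11 * a22 + a12 * - a21 = 1 by rewrite -det1; ring.
  have -> : a21 * - a12 + a22 * a11 = 1 by rewrite -det1; ring.
  have -> : a11 * - a12 + a12 * a11 = 0 by ring.
  have -> : a21 * a22 + a22 * - a21 = 0 by ring.
  by rewrite raddf0.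
apply: row_equiv_trans (row_equiv_diagl _ _ MN) _.
have -> : row_mx F%:M G%:M *m M =
    row_mx (F + c * f)%:M (G + c * g)%:M :> 'rV_(1 + 1).
  rewrite mul_row_block -!scalar_mxM -!raddfD /=.
  by congr (row_mx _%:M _%:M); rewrite -cPQ /a11 /a12 /a21 /a22; ring.
have -> : c *: h = row_mx (F + c * f)%:M (G + c * g)%:M *m
    (col_mx (P + c * p)%:M (Q + c * q)%:M *m h).
  rewrite mulmxA mul_row_col -!scalar_mxM -raddfD /= -mul_scalar_mx.
  by congr (_%:M *m _); rewrite -[LHS]cPQ'; ring.
exact: row_equiv_addr.
Qed.
End RowEquiv.

Lemma row_equiv_map (S S' : comNzRingType) (phi : {rmorphism S -> S'}) m
    (f f' : 'rV[S]_m) :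
  row_equiv f f' -> row_equiv (map_mx phi f) (map_mx phi f').
Proof.
move=> [M [N [MN ->]]]; exists (map_mx phi M), (map_mx phi N).
by rewrite -map_mxM MN map_mx1 map_mxM.
Qed.

Lemma comp_poly_shift (B : comNzRingType) (p b c a : {poly B}) :
  exists h : {poly B}, p \Po (b + c * a) = p \Po b + c * h.
Proof.
elim/poly_ind: p => [|p k [h IH]].
  by exists 0; rewrite !comp_poly0 mulr0 addr0.
exists ((p \Po b) * a + h * (b + c * a)).
rewrite !comp_poly_MXaddC IH.
by move: (p \Po b) k%:P => x y; ring.
Qed.

Section Suslin.
Variables (B : comNzRingType)
  (Bint : forall x y : B, x * y = 0 -> (x == 0) || (y == 0)).

Definition subst_row m (f : 'rV[{poly B}]_m) b : 'rV[{poly B}]_m :=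
  map_mx (comp_poly b) f.

(** Suslin's ideal. Once it contains 1, the row f(X) is equivalent to f(0),
    as is seen by translating 0 by X. *)
Definition translations m (f : 'rV[{poly B}]_m) (c : B) : Prop :=
  forall b a, row_equiv (subst_row f b) (subst_row f (b + c%:P * a)).

Lemma translations_ideal m (f : 'rV[{poly B}]_m) : is_ideal (translations f).
Proof.
split=> [b a|a x y hx hy b d]; first by rewrite mul0r addr0; exact: row_equiv_refl.
apply: row_equiv_trans (hx b (a%:P * d)) _.
have -> : b + (a * x + y)%:P * d = b + x%:P * (a%:P * d) + y%:P * d.
  by rewrite polyCD polyCM; ring.
exact: hy.
Qed.

Lemma subst_row_equiv m (f f' : 'rV[{poly B}]_m) b :
  row_equiv f f' -> row_equiv (subst_row f b) (subst_row f' b).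
Proof. exact: row_equiv_map. Qed.

Lemma translations_equiv m (f f' : 'rV[{poly B}]_m) c :
  row_equiv f f' -> translations f' c -> translations f c.
Proof.
move=> ff' h b a; apply: row_equiv_trans (subst_row_equiv b ff') _.
by apply: row_equiv_trans (h b a) _; apply/row_equiv_sym/subst_row_equiv.
Qed.

(** Any constant in the ideal of the first two entries is an admissible
    translation step: this is [row_equiv_pair] for the values of the row at b
    and at b + ca. *)
Lemma translations_pair m (F G P Q : {poly B}) (v : 'rV[{poly B}]_m) c :
  P * F + Q * G = c%:P ->
  translations (row_mx (row_mx F%:M G%:M : 'rV_(1 + 1)) v) c.
Proof.
move=> PQ; have [->|c0] := eqVneq c 0.
  by case: (translations_ideal (row_mx (row_mx F%:M G%:M) v)).
have creg (x : {poly B}) : c%:P * x = 0 -> x = 0.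
  move=> cx; apply/polyP => i; rewrite coef0.
  have := congr1 (fun q : {poly B} => q`_i) cx.
  by rewrite coefCM coef0 => /Bint; rewrite (negPf c0) => /eqP.
move=> b a; pose s p := sval (cid (comp_poly_shift p b c%:P a)).
have sE p : p \Po (b + c%:P * a) = p \Po b + c%:P * s p.
  by rewrite /s; case: cid.
have PQb d : (P \Po d) * (F \Po d) + (Q \Po d) * (G \Po d) = c%:P.
  by rewrite -!comp_polyM -comp_polyD PQ comp_polyC.
have E d : subst_row (row_mx (row_mx F%:M G%:M : 'rV_(1 + 1)) v) d =
  row_mx (row_mx (F \Po d)%:M (G \Po d)%:M : 'rV_(1 + 1)) (subst_row v d).
  by rewrite /subst_row !map_row_mx !map_scalar_mx.
rewrite !E !sE.
have -> : subst_row v (b + c%:P * a) = subst_row v b + c%:P *: map_mx s v.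
  by apply/rowP => i; rewrite !mxE sE.
apply: (row_equiv_pair _ _ creg (PQb b)) (_ : (_ + _ * s P) * _ + (_ + _ * s Q) * _ = _).
by rewrite -!sE PQb.
Qed.

End Suslin.

(** The witness is the part of p prime to q. A common factor of p and q + ar
    dividing q divides ar, hence r; one prime to q divides a, hence q. *)
Lemma coprime_shear (K : fieldType) (p q r : {poly K}) : p != 0 ->
  (forall d, d %| p -> d %| q -> d %| r -> d %| 1) ->
  exists a, coprimep p (q + a * r).
Proof.
move=> p0 hpqr; case: (gdcopP q p) => a _; rewrite (negPf p0) orbF => ca amax.
exists a; apply/coprimepP => d dp dqar.
have cdq : coprimep d q.
  apply/coprimepP => e ed eq; rewrite -size_poly_eq1 -dvdp1; apply: hpqr => //.
    exact: dvdp_trans ed dp.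
  have : e %| a * r by rewrite -(dvdp_addr _ eq); apply: dvdp_trans ed dqar.
  by rewrite Gauss_dvdpr// coprimep_sym (coprimep_dvdl eq).
have dq : d %| q.
  by rewrite -(dvdp_addl _ (dvdp_mulr r (amax d dp cdq))).
by move: (coprimep_dvdl dq cdq); rewrite coprimepp size_poly_eq1.
Qed.

Section SuslinTheorem.
Variables (B : comNzRingType)
  (Bint : forall x y : B, x * y = 0 -> (x == 0) || (y == 0)).

(** By unimodularity and [coprime_shear], some combination [G0] of the second
    entry with the later ones has image under phi prime to that of [F]. The
    resultant of [F] with [G0], the latter changed by a multiple of [F], is the
    required constant: it lies in the ideal
    they generate, and phi does not kill it. *)
Lemma translations_separate m (F G : {poly B}) (v : 'rV[{poly B}]_m) g
    (K : fieldType) (phi : {rmorphism B -> K}) :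
  (forall z, exists x, phi x = z) -> F \is monic ->
  row_mx (row_mx F%:M G%:M : 'rV_(1 + 1)) v *m g = 1%:M ->
  exists2 c, translations (row_mx (row_mx F%:M G%:M : 'rV_(1 + 1)) v) c &
    phi c != 0.
Proof.
move=> phi_surj Fmon fg1.
have lift_poly (p : {poly K}) : exists q, map_poly phi q = p.
  have [s hs] := choice phi_surj.
  exists (\poly_(i < size p) s p`_i); apply/polyP => i.
  rewrite coef_map /= coef_poly; case: ltnP => hi; first exact: hs.
  by rewrite rmorph0 nth_default.
have F0 : map_poly phi F != 0 by rewrite monic_neq0// monic_map.
pose g1 : {poly B} := usubmx (usubmx g : 'cV_(1 + 1)) 0 0.
pose g2 : {poly B} := dsubmx (usubmx g : 'cV_(1 + 1)) 0 0.
pose g3 : 'cV_m := dsubmx g.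
have FGv : F * g1 + G * g2 + (v *m g3) 0 0 = 1.
  move: fg1; rewrite -[g]vsubmxK -[usubmx g]vsubmxK !mul_row_col.
  move=> /matrixP/(_ 0 0); rewrite !mxE !big_ord1 !mxE eqxx !mulr1n => <-.
  by rewrite /g1 /g2 !mxE.
have [|a ha] := @coprime_shear K (map_poly phi F) (map_poly phi G)
    (map_poly phi ((v *m g3) 0 0)) F0.
  move=> d dF dG dv; rewrite -(rmorph1 (map_poly phi)) -FGv !rmorphD !rmorphM /=.
  by rewrite !dvdp_add// dvdp_mulr.
have [a' a'E] := lift_poly a.
pose G0 := G + a' * (v *m g3) 0 0.
have G0E x : translations (row_mx (row_mx F%:M G0%:M : 'rV_(1 + 1)) v) x ->
    translations (row_mx (row_mx F%:M G%:M : 'rV_(1 + 1)) v) x.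
  apply: translations_equiv.
  have -> : row_mx F%:M G0%:M = row_mx F%:M G%:M + v *m row_mx 0 (a' *: g3)
      :> 'rV_(1 + 1).
    rewrite mul_mx_row mulmx0 add_row_mx addr0; congr row_mx.
    rewrite -scalemxAr [v *m g3]mx11_scalar scale_scalar_mx -raddfD.
    by [].
  exact: row_equiv_addl.
have [F1|F1] := leqP (size F) 1.
  exists 1; last by rewrite rmorph1 oner_eq0.
  apply/G0E/(translations_pair Bint (P := 1) (Q := 0)).
  rewrite mul1r mul0r addr0.
  have := size1_polyC F1; move/monicP: Fmon => Fl FC.
  by rewrite FC -(lead_coefC F`_0) -FC Fl.
(* Adding a multiple of the monic F makes G0 monic, so that phi preserves both
   degrees and therefore the shape of the Sylvester matrix. *)
pose N := size G0; pose G1 := G0 + 'X^N * F.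
have sXF : size ('X^N * F) = (N + size F)%N.
  by rewrite (size_monicM (monicXn B N) (monic_neq0 Fmon)) size_polyXn.
have sG01 : (size G0 < size ('X^N * F)%R)%N.
  by rewrite sXF -/N -[ltnLHS]addn0 ltn_add2l; apply: ltn_trans F1.
have sG1 : size G1 = (N + size F)%N by rewrite /G1 addrC size_polyDl.
have G1mon : G1 \is monic.
  rewrite /G1 addrC monicE lead_coefDl//.
  by rewrite lead_coef_monicM ?monicXn//; exact/eqP/monicP.
have [|[P Q] _ /= EPQ] := @resultant_in_ideal B F G1 F1.
  by rewrite sG1; lia.
exists (resultant F G1).
  apply/G0E/(translations_pair Bint (P := P + Q * 'X^N) (Q := Q)).
  by rewrite EPQ /G1; ring.
have -> : phi (resultant F G1) = resultant (map_poly phi F) (map_poly phi G1).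
  rewrite /resultant /Sylvester_mx !size_map_poly_id0//; last 2 first.
  - by rewrite (monicP Fmon) rmorph1 oner_eq0.
  - by rewrite (monicP G1mon) rmorph1 oner_eq0.
  rewrite -det_map_mx /= map_col_mx; congr (\det (col_mx _ _));
    by apply: map_lin1_mx => w; rewrite map_poly_rV rmorphM /= map_rVpoly.
rewrite resultant_eq0 -leqNgt.
have -> : map_poly phi G1 = 'X^N * map_poly phi F +
    (map_poly phi G + a * map_poly phi ((v *m g3) 0 0)).
  by rewrite -a'E /G1 /G0 !rmorphD !rmorphM /= map_polyXn addrC.
by move: ha; rewrite -(coprimep_addl_mul 'X^N) coprimep_def => /eqP ->.
Qed.

(** By [translations_separate] the ideal of translations is contained in no
    maximal ideal. *)
Lemma suslin_row_equiv m (F G : {poly B}) (v : 'rV[{poly B}]_m) g :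
  F \is monic -> row_mx (row_mx F%:M G%:M : 'rV_(1 + 1)) v *m g = 1%:M ->
  let f := row_mx (row_mx F%:M G%:M : 'rV_(1 + 1)) v in
  row_equiv (subst_row f 0) f.
Proof.
move=> Fmon fg1 f.
have [h|n1] := pselect (translations f 1).
  have := h 0 'X; rewrite mul1r add0r.
  by rewrite [X in row_equiv _ X](_ : _ = f)//; apply/rowP => i; rewrite mxE comp_polyXr.
have [K [phi [kill surj]]] := field_killing_ideal (translations_ideal f) n1.
have [c /kill ->] := translations_separate surj Fmon fg1.
by rewrite eqxx.
Qed.
End SuslinTheorem.

(** * Idempotent matrices and stably free modules *)

Section Splitting.
Variable A : comNzRingType.

(** The image of [E] is a free module: [X] and [Y] are inverse isomorphisms
    between it and the module of rows of length r. *)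
Definition splits n (E : 'M[A]_n) : Prop :=
  exists r (X : 'M[A]_(n, r)) (Y : 'M[A]_(r, n)), X *m Y = E /\ Y *m X = 1%:M.

Definition projfree : Prop :=
  forall n (E : 'M[A]_n), E *m E = E -> splits E.

(** The kernel of the map given by a unimodular row is free. *)
Definition splits_off m (f : 'rV[A]_m) : Prop :=
  forall g : 'cV[A]_m, f *m g = 1%:M -> splits (1%:M - g *m f).

Lemma splits_off_equiv m (f f' : 'rV[A]_m) :
  row_equiv f f' -> splits_off f -> splits_off f'.
Proof.
move=> [M [N [MN ->]]] hf g fg; have NM := mulmx1C MN.
have [|r [X [Y [XY YX]]]] := hf (M *m g); first by rewrite mulmxA.
exists r, (N *m X), (Y *m M); split.
  rewrite mulmxA -(mulmxA N) XY mulmxBr mulmxBl mulmx1 NM.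
  by rewrite !mulmxA NM mul1mx.
by rewrite mulmxA -(mulmxA Y) MN mulmx1.
Qed.

(** The projections attached to two right inverses of f have the same image,
    the kernel of f. *)
Lemma splits_off_any m (f : 'rV[A]_m) g : f *m g = 1%:M ->
  splits (1%:M - g *m f) -> splits_off f.
Proof.
move=> fg [r [X [Y [XY YX]]]] g' fg'.
have fX : f *m X = 0.
  rewrite -[X]mulmx1 -YX (mulmxA X) XY mulmxA mulmxBr mulmx1 mulmxA fg mul1mx.
  by rewrite subrr mul0mx.
exists r, X, (Y *m (1%:M - g' *m f)); split.
  rewrite mulmxA XY mulmxBr mulmx1 [X in _ - X]mulmxA [X in _ - X *m _]mulmxBl.
  by rewrite mul1mx -mulmxA fg' mulmx1 mulmxBl opprB addrA subrK.
by rewrite -mulmxA mulmxBl mul1mx -mulmxA fX mulmx0 subr0.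
Qed.

(** The kernel of a split surjection onto a free module of rank m is reached by
    cutting with one coordinate at a time; each cut is the kernel of a single
    unimodular row on a free module. *)
Lemma kernel_splits : (forall m (f : 'rV[A]_m), splits_off f) ->
  forall m k (U : 'M[A]_(m, k)) (T : 'M[A]_(k, m)),
  U *m T = 1%:M -> splits (1%:M - T *m U).
Proof.
move=> herm; elim=> [k U T _|m IHm k].
  exists k, 1%:M, 1%:M; rewrite !mulmx1; split => //.
  by rewrite [T]thinmx0 mul0mx subr0.
rewrite -[m.+1]/(1 + m)%N => U T; rewrite -[U]vsubmxK -[T]hsubmxK.
set u : 'rV_k := usubmx U; set U' := dsubmx U.
set s : 'cV_k := lsubmx T; set T' := rsubmx T.
rewrite mul_col_row scalar_mx_block => /eq_block_mx[us uT' U's U'T'].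
have [r [X [Y [XY YX]]]] := herm k u s us.
have XYT' : X *m (Y *m T') = T'.
  by rewrite mulmxA XY mulmxBl mul1mx -mulmxA uT' mulmx0 subr0.
have U'XY : U' *m X *m Y = U'.
  by rewrite -mulmxA XY mulmxBr mulmx1 mulmxA U's mul0mx subr0.
have [|q [X1 [Y1 [XY1 YX1]]]] := IHm r (U' *m X) (Y *m T').
  by rewrite mulmxA U'XY.
exists q, (X *m X1), (Y1 *m Y); split.
  rewrite mulmxA -(mulmxA X) XY1 mulmxBr mulmx1 mulmxBl XY.
  rewrite mul_row_col [X in _ - X = _](_ : _ = T' *m U').
    by rewrite opprD addrA.
  have -> : X *m (Y *m T' *m (U' *m X)) *m Y =
      X *m (Y *m T') *m (U' *m X *m Y) by rewrite !mulmxA.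
  by rewrite XYT' U'XY.
by rewrite mulmxA -(mulmxA Y1) YX mulmx1.
Qed.

(* P + A^m = A^k implies P free *)
(** [H], [C] and [U], [T] exhibit the direct sum of the image of [E] and a free
    module of rank m as a free module of rank k, so that image is isomorphic to
    the kernel of [U]. *)
Lemma stably_free_splits : (forall m (f : 'rV[A]_m), splits_off f) ->
  forall n m k (E : 'M[A]_n) (H : 'M_(n, k)) (C : 'M_(k, n))
    (U : 'M[A]_(m, k)) (T : 'M[A]_(k, m)),
  E *m E = E -> U *m T = 1%:M -> H *m C = E -> C *m H = 1%:M - T *m U -> splits E.
Proof.
move=> herm n m k E H C U T EE UT HC CH.
have [r [X [Y [XY YX]]]] := kernel_splits herm UT.
exists r, (H *m X), (Y *m C); split.
  by rewrite mulmxA -(mulmxA H) XY -CH mulmxA HC -mulmxA HC EE.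
by rewrite mulmxA -(mulmxA Y) CH -XY mulmxA YX mul1mx YX.
Qed.
End Splitting.

Lemma splits_map (A A' : comNzRingType) (phi : {rmorphism A -> A'}) n
  (E : 'M[A]_n) : splits E -> splits (map_mx phi E).
Proof.
move=> [r [X [Y [XY YX]]]]; exists r, (map_mx phi X), (map_mx phi Y).
by rewrite -!map_mxM XY YX map_mx1.
Qed.

(** * Weierstrass division *)

Section Weierstrass.
Variables (A B : comNzRingType) (iota : {rmorphism B -> A}) (t : A).

Definition ev : {poly B} -> A := horner_eval t \o map_poly iota.
HB.instance Definition _ := GRing.RMorphism.on ev.

Lemma evC b : ev b%:P = iota b.
Proof. by rewrite /ev /= /horner_eval map_polyC hornerC. Qed.

Lemma evX : ev 'X = t.
Proof. by rewrite /ev /= /horner_eval map_polyX hornerX. Qed.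

Lemma evZ b p : ev (b *: p) = iota b * ev p.
Proof. by rewrite -mul_polyC rmorphM /= evC. Qed.

Lemma ev_wide d (p : {poly B}) : (size p <= d)%N ->
  ev p = \sum_(j < d) iota p`_j * t ^+ j.
Proof.
move=> sp; rewrite /ev /= /horner_eval (@horner_coef_wide _ d).
  by apply: eq_bigr => j _; rewrite coef_map.
by apply: leq_trans sp; apply: size_poly.
Qed.

(** The quotient of [A] by [ev w] is free over [B], with the powers of [t] below
    the degree of [w] as a basis. It is therefore the same ring as the quotient
    of B[X] by w, and through it questions are carried between [A] and
    polynomials over [B]. *)
Record weierstrass_division (w : {poly B}) : Prop := WeierstrassDivision {
  wd_monic : w \is monic;
  wd_inj : forall p, ev p = 0 -> p = 0;
  wd_div : forall a, exists q p, a = q * ev w + ev p /\ (size p < size w)%N;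
  wd_uniq : forall q (p : {poly B}),
    (size p < size w)%N -> q * ev w + ev p = 0 -> q = 0 }.

Variable w : {poly B}.
Hypothesis hw : weierstrass_division w.
Notation W := (ev w).

Let w_gt0 : (0 < size w)%N.
Proof. by rewrite size_poly_gt0 monic_neq0// (wd_monic hw). Qed.

Lemma wd_reg a : a * W = 0 -> a = 0.
Proof.
move=> aW; apply: (wd_uniq hw (p := 0)); first by rewrite size_poly0.
by rewrite rmorph0 addr0.
Qed.

Lemma wd_unique q q' (p p' : {poly B}) : (size p < size w)%N -> (size p' < size w)%N ->
  q * W + ev p = q' * W + ev p' -> q = q' /\ p = p'.
Proof.
move=> sp sp' E.
have E0 : (q - q') * W + ev (p - p') = 0.
  by rewrite rmorphB mulrBl addrACA -opprD E subrr.
have q0 : q - q' = 0.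
  apply: (wd_uniq hw _ E0); apply: leq_ltn_trans (size_polyD _ _) _.
  by rewrite gtn_max size_polyN sp.
split; apply/eqP; rewrite -subr_eq0; first exact/eqP.
by apply/eqP/(wd_inj hw); rewrite q0 mul0r add0r in E0.
Qed.

(** Injectivity of B[X]/w -> A/w(t). *)
Lemma wd_dvd p z : ev p = z * W -> exists s, p = s * w.
Proof.
move=> pz; have Ep := Pdiv.RingMonic.rdivp_eq (wd_monic hw) p.
have sr : (size (Pdiv.Ring.rmodp p w) < size w)%N.
  by rewrite Pdiv.Ring.ltn_rmodpN0// monic_neq0// (wd_monic hw).
have [] := @wd_unique z (ev (Pdiv.Ring.rdivp p w)) 0 (Pdiv.Ring.rmodp p w).
- by rewrite size_poly0.
- by [].
- by rewrite rmorph0 addr0 -pz {1}Ep rmorphD rmorphM.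
by move=> _ r0; exists (Pdiv.Ring.rdivp p w); rewrite {1}Ep -r0 addr0.
Qed.

Lemma wd_quorem : exists (quo : A -> A) (rem : A -> {poly B}),
  (forall a, a = quo a * W + ev (rem a)) /\ (forall a, (size (rem a) < size w)%N).
Proof.
have h a : exists qp : A * {poly B},
    a = qp.1 * W + ev qp.2 /\ (size qp.2 < size w)%N.
  by have [q [p h]] := wd_div hw a; exists (q, p).
have [s hs] := choice h; exists (fun a => (s a).1), (fun a => (s a).2).
by split=> a; have [] := hs a.
Qed.

(** Modulo its first entry w(t), the row may be replaced by a row of
    polynomials with first entry w. That row is already unimodular over B[X],
    because A and B[X] have the same quotient by w, so Suslin's theorem makes it
    equivalent to a row over B. *)
Lemma splits_off_weierstrass m (G : A) (v : 'rV[A]_m) :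
  projfree B -> (forall x y : B, x * y = 0 -> (x == 0) || (y == 0)) ->
  splits_off (row_mx (row_mx W%:M G%:M : 'rV_(1 + 1)) v).
Proof.
move=> Bfree Bint; have [quo [rem [qrE srem]]] := wd_quorem.
have remE a : ev (rem a) = a - quo a * W.
  by rewrite [X in X - _]qrE addrC addKr.
pose f1 : 'rV[{poly B}]_(1 + 1 + m) := 
  row_mx (row_mx w%:M (rem G)%:M : 'rV_(1 + 1)) (map_mx rem v).
have f_f1 : row_equiv (row_mx (row_mx W%:M G%:M : 'rV_(1 + 1)) v) (map_mx ev f1).
  rewrite !map_row_mx !map_scalar_mx /=.
  apply: (@row_equiv_trans _ _
    (row_mx (row_mx W%:M (ev (rem G))%:M : 'rV_(1 + 1)) v)).
    have := @row_equiv_addr A _ _ (W%:M : 'rV_1) (G%:M : 'rV_1) (- quo G)%:M.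
    rewrite -scalar_mxM -raddfD /= => -[M [N [MN E]]].
    have -> : ev (rem G) = G + W * - quo G.
      by rewrite remE mulrN mulrC.
    rewrite E; exact: row_equiv_diagl MN.
  have -> : map_mx ev (map_mx rem v) = v +
      row_mx W%:M (ev (rem G))%:M *m (col_mx 1%:M 0 *m map_mx (fun a => - quo a) v).
    rewrite mulmxA mul_row_col mulmx1 mulmx0 addr0 mul_scalar_mx.
    by apply/rowP => i; rewrite !mxE remE mulrN mulrC.
  exact: row_equiv_addr.
apply: splits_off_equiv (row_equiv_sym f_f1) _ => g f1g.
have [g1 f1g1] : exists g1, f1 *m g1 = 1%:M.
  pose a := usubmx (usubmx g : 'cV_(1 + 1)) 0 0 : A.
  pose b := dsubmx (usubmx g : 'cV_(1 + 1)) 0 0 : A.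
  pose c : 'cV_m := dsubmx g.
  have E : W * a + ev (rem G) * b + (map_mx ev (map_mx rem v) *m c) 0 0 = 1.
    move: f1g; rewrite !map_row_mx !map_scalar_mx -[g]vsubmxK -[usubmx g]vsubmxK.
    rewrite !mul_row_col => /matrixP/(_ 0 0).
    rewrite !mxE !big_ord1 !mxE eqxx !mulr1n => <-.
    by rewrite /a /b !mxE.
  move: a b c E => a b c E.
  pose p := rem G * rem b + (map_mx rem v *m map_mx rem c) 0 0 - 1.
  have [s ps] : exists s, p = s * w.
    apply: (@wd_dvd p (- (a + ev (rem G) * quo b +
      (map_mx ev (map_mx rem v) *m map_mx quo c) 0 0))).
    rewrite /p rmorphB rmorphD rmorphM rmorph1 -E /=.
    have -> : ev ((map_mx rem v *m map_mx rem c) 0 0) =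
      (map_mx ev (map_mx rem v) *m c) 0 0 -
      (map_mx ev (map_mx rem v) *m map_mx quo c) 0 0 * W.
      rewrite !mxE rmorph_sum mulr_suml -sumrB; apply: eq_bigr => j _.
      by rewrite !mxE rmorphM /= (remE (c j 0)); ring.
    by rewrite (remE b); ring.
  exists (col_mx (col_mx (- s)%:M (rem b)%:M : 'cV_(1 + 1)) (map_mx rem c)).
  rewrite !mul_row_col -!scalar_mxM [map_mx _ _ *m _]mx11_scalar -!raddfD /=.
  congr (_%:M); rewrite mulrN mulrC -ps /p; ring.
have Fequiv := suslin_row_equiv Bint (wd_monic hw) f1g1.
have := row_equiv_map (GRing.RMorphism.clone _ _ ev _) Fequiv.
move=> /splits_off_equiv; apply => //.
pose f0 : 'rV[B]_(1 + 1 + m) := map_mx (horner_eval 0) f1.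
pose g0 := map_mx (horner_eval 0) g1.
have f0g0 : f0 *m g0 = 1%:M by rewrite -map_mxM f1g1 map_mx1.
have -> : map_mx ev (subst_row f1 0) = map_mx iota f0.
  by apply/rowP => i; rewrite !mxE comp_poly0r evC /horner_eval horner_coef0.
apply: (@splits_off_any _ _ _ (map_mx iota g0)).
  by rewrite -map_mxM f0g0 map_mx1.
rewrite -map_mxM -(map_mx1 iota) -map_mxB; apply/splits_map/Bfree.
rewrite mulmxBl mul1mx mulmxBr mulmx1 mulmxA -(mulmxA g0) f0g0 mulmx1.
by rewrite subrr subr0.
Qed.
End Weierstrass.

(** * Stable freeness *)

Lemma lin1_mxP (B : nzRingType) (m n : nat) (h : 'rV[B]_m -> 'rV[B]_n) :
  (forall b u v, h (b *: u + v) = b *: h u + h v) ->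
  exists M, forall u, u *m M = h u.
Proof.
move=> hlin; pose mix := GRing.isLinear.Build B _ _ _ h hlin.
pose hL : {linear 'rV[B]_m -> 'rV[B]_n} := HB.pack h mix.
by exists (lin1_mx hL) => u; rewrite mul_rV_lin1.
Qed.

Lemma additive0 (U V : zmodType) (h : U -> V) :
  {morph h : x y / x + y} -> h 0 = 0.
Proof. by move=> hD; apply: (@addrI _ (h 0)); rewrite -hD !addr0. Qed.

Lemma row_choice (R : Type) m n (P : 'I_m -> 'rV[R]_n -> Prop) :
  (forall i, exists x, P i x) -> exists M : 'M[R]_(m, n), forall i, P i (row i M).
Proof.
move=> h; have [s hs] := choice h.
by exists (\matrix_i s i) => i; rewrite rowK.
Qed.

Section StablyFree.
Variables (A B : comNzRingType) (iota : {rmorphism B -> A}) (t : A).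
Variables (w : {poly B}) (hw : weierstrass_division iota t w).
Hypothesis Bfree : projfree B.
Notation ev := (ev iota t).
Notation W := (ev w).

Variables (n r : nat) (E : 'M[A]_n) (X : 'M[A]_(r, n)) (Y : 'M[A]_(n, r)).
Hypotheses (XY : X *m Y = W%:M) (YX : Y *m X = W *: E).
Hypothesis Aint : forall x y : A, x * y = 0 -> (x == 0) || (y == 0).
Hypothesis EE : E *m E = E.
Hypothesis EY : E *m Y = Y.

(** The rows u Y form a submodule L of A^r, isomorphic to the image of [E]; it
    contains w(t) A^r, so A^r/L is finite over B. It is also projective over B:
    taking the quotients by w(t) of the entries of v X, then multiplying by [Y],
    is a B-linear retraction of A^r onto L, as v X = w(t) u when v = u Y with
    u E = u. Hence A^r/L is free over B, and [alpha] is the projection onto it,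
    with B-linear section [beta]. *)
Lemma weierstrass_quotient_free :
  exists (m : nat) (alpha : 'rV[A]_r -> 'rV[B]_m) (beta : 'rV[B]_m -> 'rV[A]_r),
  [/\ forall b u v, alpha (iota b *: u + v) = b *: alpha u + alpha v,
      forall b u v, beta (b *: u + v) = iota b *: beta u + beta v,
      forall e, alpha (beta e) = e,
      forall a v, alpha (a *: beta (alpha v)) = alpha (a *: v) &
      forall v, alpha v = 0 <-> exists u, v = u *m Y].
Proof.
have [quo [rem [qrE srem]]] := wd_quorem hw.
have qrlin b x y : quo (iota b * x + y) = iota b * quo x + quo y /\
    rem (iota b * x + y) = b *: rem x + rem y.
  apply: (wd_unique hw) => //.
    apply: leq_ltn_trans (size_polyD _ _) _; rewrite gtn_max srem andbT.
    by apply: leq_ltn_trans (srem x); apply: size_scale_leq.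
  by rewrite -qrE rmorphD /= evZ {1}(qrE x) {1}(qrE y); ring.
have quoM x : quo (x * W) = x.
  have [] // := @wd_unique _ _ _ _ _ hw (quo (x * W)) x (rem (x * W)) 0.
    by rewrite size_poly0 size_poly_gt0 monic_neq0// (wd_monic hw).
  by rewrite -qrE rmorph0 addr0.
(* The B-linear projection of A^r with kernel L. *)
pose Gam (v : 'rV[A]_r) := v - map_mx quo (v *m X) *m Y.
have Gamlin b u v : Gam (iota b *: u + v) = iota b *: Gam u + Gam v.
  have -> : Gam (iota b *: u + v) = iota b *: u + v -
     (iota b *: map_mx quo (u *m X) + map_mx quo (v *m X)) *m Y.
    rewrite /Gam mulmxDl -scalemxAl; congr (_ - _ *m _).
    by apply/rowP => i; rewrite !mxE (qrlin b _ _).1.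
  by rewrite mulmxDl -scalemxAl /Gam scalerBr opprD addrACA.
have GamD u v : Gam (u + v) = Gam u + Gam v.
  by rewrite -[u]scale1r -(rmorph1 iota) Gamlin rmorph1 !scale1r.
have GamY u : Gam (u *m Y) = 0.
  rewrite /Gam -mulmxA YX -scalemxAr.
  have -> : map_mx quo (W *: (u *m E)) = u *m E.
    by apply/rowP => i; rewrite mxE [X in quo X]mxE mulrC quoM.
  by rewrite -mulmxA EY subrr.
have Gam0 v : Gam v = 0 -> v = map_mx quo (v *m X) *m Y.
  by move/eqP; rewrite subr_eq0 => /eqP.
have GamBY v u : Gam (v - u *m Y) = Gam v.
  by rewrite -mulNmx GamD GamY addr0.
have GamK v : Gam (Gam v) = Gam v by rewrite {2}/Gam GamBY.
have GamW v : Gam (W *: v) = 0.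
  by rewrite -mul_mx_scalar -XY mulmxA GamY.
pose d := (size w).-1.
have sremd a : (size (rem a) <= d)%N by rewrite -ltnS (ltn_predK (srem a)) srem.
(* pi gives the coordinates of a row of A^r modulo w(t), on the powers of t of
   each basis vector; sig lifts coordinates back. *)
pose pi (v : 'rV[A]_r) : 'rV[B]_(r * d) :=
  mxvec (\matrix_(i < r, j < d) (rem (v 0 i))`_j).
pose sig (e : 'rV[B]_(r * d)) : 'rV[A]_r :=
  \row_i \sum_(j < d) iota (vec_mx e i j) * t ^+ j.
have pilin b u v : pi (iota b *: u + v) = b *: pi u + pi v.
  rewrite /pi -linearZ -linearD; congr mxvec; apply/matrixP => i j.
  by rewrite !mxE (qrlin b _ _).2 coefD coefZ.
have siglin b u v : sig (b *: u + v) = iota b *: sig u + sig v.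
  apply/rowP => i; rewrite !mxE mulr_sumr -big_split; apply: eq_bigr => j _.
  by rewrite linearD linearZ /= !mxE rmorphD rmorphM /= mulrDl mulrA.
have sigpi v : v = W *: map_mx quo v + sig (pi v).
  apply/rowP => i; rewrite !mxE [LHS]qrE mulrC; congr (_ + _).
  rewrite (ev_wide iota t (sremd _)); apply: eq_bigr => j _.
  by rewrite mxvecK mxE.
have Gamsigpi v : Gam (sig (pi v)) = Gam v.
  by rewrite [in RHS](sigpi v) GamD GamW add0r.
have [|G GE] := @lin1_mxP B _ _ (fun e => pi (Gam (sig e))).
  by move=> b u v; rewrite siglin Gamlin pilin.
have GG : G *m G = G.
  apply/row_matrixP => i; rewrite !rowE mulmxA !GE.
  by rewrite Gamsigpi GamK.
have [m [X' [Y' [XY' YX']]]] := Bfree GG.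
exists m, (fun v => pi (Gam v) *m X'), (fun e => Gam (sig (e *m Y'))).
have betaalpha v : Gam (sig (pi (Gam v) *m X' *m Y')) = Gam v.
  by rewrite -mulmxA XY' GE !Gamsigpi !GamK.
split=> [b u v|b u v|e|a v|v].
- by rewrite Gamlin pilin mulmxDl -scalemxAl.
- by rewrite mulmxDl -scalemxAl siglin Gamlin.
- by rewrite GamK -GE -XY' !mulmxA -!mulmxA YX' mulmx1 YX' mulmx1.
- rewrite betaalpha; congr (pi _ *m X').
  by rewrite {2}/Gam scalerBr scalemxAl GamBY.
- split=> [v0|[u ->]].
    exists (map_mx quo (v *m X)); apply: Gam0; rewrite -betaalpha v0 mul0mx.
    have sig0 : sig 0 = 0.
      apply: additive0 => y z.
      by rewrite -[y]scale1r siglin rmorph1 !scale1r.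
    by rewrite sig0 -[X in Gam X](mul0mx 1 Y) GamY.
  rewrite GamY; have -> : pi 0 = 0.
    apply: additive0 => y z.
    by rewrite -[y]scale1r -(rmorph1 iota) pilin rmorph1 !scale1r.
  by rewrite mul0mx.
Qed.

(** Let t act on Q = A^r/L = B^m by the matrix phi. Then Q is the cokernel of
    t - phi acting on A^m, so two presentations of Q by free modules with kernels
    L and A^m are at hand, and Schanuel's comparison makes L stably free. In
    matrices: t - phi stacked on the matrix V of the images of the basis of A^r
    is a split surjection A^(m+r) -> A^m with kernel isomorphic to L. *)
Lemma weierstrass_stably_free :
  exists (m k : nat) (H : 'M[A]_(n, k)) (C : 'M[A]_(k, n))
    (U : 'M[A]_(m, k)) (T : 'M[A]_(k, m)),
  [/\ U *m T = 1%:M, H *m C = E & C *m H = 1%:M - T *m U].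
Proof.
have [m [al [be [allin belin albe albeal alY]]]] := weierstrass_quotient_free.
have alD u v : al (u + v) = al u + al v.
  by rewrite -[u]scale1r -(rmorph1 iota) allin rmorph1 !scale1r.
have beD u v : be (u + v) = be u + be v.
  by rewrite -[u]scale1r belin rmorph1 !scale1r.
have alB u v : al (u - v) = al u - al v.
  by rewrite -scaleN1r addrC -(rmorphN1 iota) allin scaleN1r addrC.
have al0 : al 0 = 0 by apply: additive0.
have be0 : be 0 = 0 by apply: additive0.
have alZ b v : al (iota b *: v) = b *: al v.
  by rewrite -[_ *: v]addr0 allin al0 addr0.
have beZ b v : be (b *: v) = iota b *: be v.
  by rewrite -[_ *: v]addr0 belin be0 addr0.
have alW v : al (W *: v) = 0.
  by apply/alY; exists (v *m X); rewrite -mulmxA XY mul_mx_scalar.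
have alsum (I : finType) (f : I -> 'rV[A]_r) : al (\sum_i f i) = \sum_i al (f i).
  by apply: (big_morph al alD al0).
have besum (I : finType) (f : I -> 'rV[B]_m) : be (\sum_i f i) = \sum_i be (f i).
  by apply: (big_morph be beD be0).
have [|phi phiE] := @lin1_mxP B _ _ (fun e => al (t *: be e)).
  by move=> b u v; rewrite belin scalerDr scalerA mulrC -scalerA allin.
pose V : 'M[B]_(r, m) := \matrix_i al (delta_mx 0 i).
pose V' := map_mx iota V.
pose Phi : 'M[A]_m := t%:M - map_mx iota phi.
have ev0 p : ev p = 0 -> p = 0 by apply: (wd_inj hw).
have PhiE e : map_mx iota e *m Phi = t *: map_mx iota e - map_mx iota (e *m phi).
  by rewrite mulmxBr mul_mx_scalar map_mxM.
(* A acts on Q = B^m through alpha and beta; modulo the image of t - phi, an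
   element of A multiplies vectors over B by this action. *)
have polyred p e : exists x, ev p *: map_mx iota e =
    map_mx iota (al (ev p *: be e)) + x *m Phi.
  elim/poly_ind: p e => [|p c IH] e.
    by exists 0; rewrite rmorph0 !scale0r al0 mul0mx addr0 map_mx0.
  have [x hx] := IH (e *m phi); exists (x + ev p *: map_mx iota e).
  rewrite rmorphD rmorphM /= evX evC scalerDl -scalerA.
  have -> : t *: map_mx iota e =
      map_mx iota (e *m phi) + map_mx iota e *m Phi by rewrite PhiE addrC subrK.
  rewrite scalerDr hx phiE albeal scalerA.
  have -> : iota c *: map_mx iota e = map_mx iota (c *: e).
    by rewrite map_mxZ.
  rewrite [(ev p * t + iota c) *: _]scalerDl alD alZ albe map_mxD.
  by rewrite mulmxDl scalemxAl -[LHS]addrA [X in _ + X = _]addrC addrACA.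
have red a e : exists x, a *: map_mx iota e =
    map_mx iota (al (a *: be e)) + x *m Phi.
  have [q [p [-> _]]] := wd_div hw a.
  have [x1] := polyred w e; rewrite alW map_mx0 add0r => h1.
  have [x2 h2] := polyred p e; exists (q *: x1 + x2).
  rewrite scalerDl -scalerA h1 h2 mulmxDl -scalemxAl addrCA; congr (_ + _).
  by rewrite scalerDl mulrC -scalerA alD alW add0r.
have Vrow i : row i V' = map_mx iota (al (delta_mx 0 i)).
  by rewrite -map_row rowK.
have redV y : exists x, y *m V' = map_mx iota (al y) + x *m Phi.
  have h i : exists x, y 0 i *: row i V' =
      map_mx iota (al (y 0 i *: delta_mx 0 i)) + x *m Phi.
    by have [x hx] := red (y 0 i) (al (delta_mx 0 i)); exists x;
      rewrite Vrow hx albeal.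
  have [s hs] := choice h; exists (\sum_i s i).
  rewrite mulmx_sum_row (eq_bigr _ (fun i _ => hs i)) big_split /=.
  rewrite mulmx_suml; congr (_ + _).
  by rewrite [in RHS](row_sum_delta y) alsum (raddf_sum (map_mx iota)).
(* Conversely, v |-> alpha (v Be) is the map from A^m to Q killing the image of
   t - phi, and it recovers alpha y from y V'. *)
pose Be : 'M[A]_(m, r) := \matrix_i be (delta_mx 0 i).
have BeE e : map_mx iota e *m Be = be e.
  rewrite [in RHS](row_sum_delta e) besum mulmx_sum_row; apply: eq_bigr => i _.
  by rewrite beZ rowK mxE.
have al2Phi x : al (x *m Phi *m Be) = 0.
  rewrite -mulmxA mulmx_sum_row alsum big1// => i _.
  have -> : row i (Phi *m Be) = t *: be (delta_mx 0 i) - be (delta_mx 0 i *m phi).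
    rewrite row_mul rowE -(map_delta_mx iota) PhiE mulmxBl -scalemxAl.
    by rewrite !BeE.
  by rewrite phiE scalerBr alB albeal subrr.
have al2V y : al (y *m V' *m Be) = al y.
  rewrite -mulmxA mulmx_sum_row [in RHS](row_sum_delta y) !alsum.
  by apply: eq_bigr => i _; rewrite row_mul Vrow BeE albeal.
have kerU x y : x *m Phi + y *m V' = 0 -> al y = 0.
  move=> xy; have : al (x *m Phi *m Be + y *m V' *m Be) = 0.
    by rewrite -mulmxDl xy mul0mx al0.
  by rewrite alD al2Phi al2V add0r.
pose U : 'M[A]_(m + r, m) := col_mx Phi V'.
have [T TU] : exists T : 'M[A]_(m, m + r), T *m U = 1%:M.
  have [|T hT] := @row_choice A m (m + r) (fun i z => z *m U = row i 1%:M).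
    move=> i; have [x hx] := redV (be (delta_mx 0 i)).
    exists (row_mx (- x) (be (delta_mx 0 i))).
    rewrite mul_row_col hx albe map_delta_mx mulNmx addrCA addNr addr0.
    by rewrite rowE mulmx1.
  by exists T; apply/row_matrixP => i; rewrite row_mul.
have [Z ZPhi] : exists Z : 'M[A]_(n, m), Z *m Phi = Y *m V'.
  have [|Z hZ] := @row_choice A n m (fun i z => z *m Phi = row i (Y *m V')).
    move=> i; have [x hx] := redV (row i Y); exists x.
    rewrite row_mul hx (_ : al _ = 0) ?map_mx0 ?add0r//.
    by apply/alY; exists (delta_mx 0 i); rewrite -rowE.
  by exists Z; apply/row_matrixP => i; rewrite row_mul.
pose C' : 'M[A]_(n, m + r) := row_mx (- Z) Y.
have C'U : C' *m U = 0 by rewrite mul_row_col mulNmx ZPhi addNr.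
pose D : 'M[A]_(m + r) := 1%:M - U *m T.
have DU : D *m U = 0 by rewrite mulmxBl mul1mx -mulmxA TU mulmx1 subrr.
have DU' : lsubmx D *m Phi + rsubmx D *m V' = 0.
  by rewrite -mul_row_col hsubmxK.
have [H HY] : exists H : 'M[A]_(m + r, n), H *m Y = rsubmx D.
  have [|H hH] := @row_choice A (m + r) n (fun i z => z *m Y = row i (rsubmx D)).
    move=> i; have /alY[u ->] : al (row i (rsubmx D)) = 0; last by exists u.
    apply: (kerU (row i (lsubmx D))).
    by rewrite -!row_mul -raddfD /= DU' row0.
  by exists H; apply/row_matrixP => i; rewrite row_mul.
(* The determinant of t - phi is the value at t of a monic polynomial. *)
have Phireg q (x : 'M[A]_(q, m)) : x *m Phi = 0 -> x = 0.
  move=> xP; have : x *m (Phi *m \adj Phi) = 0 by rewrite mulmxA xP mul0mx.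
  rewrite mul_mx_adj mul_mx_scalar.
  have -> : \det Phi = ev (char_poly phi).
    rewrite /char_poly -det_map_mx; congr (\det _); apply/matrixP => i j.
    by rewrite !mxE rmorphB rmorphMn /= evX evC.
  move=> dx; apply/matrixP => i j; move/matrixP/(_ i j): dx; rewrite !mxE.
  move=> /Aint /orP[|/eqP//].
  by move=> /eqP /ev0 /eqP; rewrite (negPf (monic_neq0 (char_poly_monic phi))).
have Wreg q s (x : 'M[A]_(q, s)) : W *: x = 0 -> x = 0.
  move=> Wx; apply/matrixP => i j; move/matrixP/(_ i j): Wx; rewrite !mxE mulrC.
  exact: (wd_reg hw).
have EC'H : E *m C' *m H *m E = E.
  apply/eqP; rewrite -subr_eq0; apply/eqP/Wreg.
  have : (E *m C' *m H *m Y - E *m Y) *m X = 0.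
    rewrite -!mulmxA HY.
    have -> : C' *m rsubmx D = rsubmx (C' *m D).
      by rewrite -{2}[D]hsubmxK mul_mx_row row_mxKr.
    rewrite /D mulmxBr mulmx1 mulmxA C'U mul0mx subr0 row_mxKr.
    by rewrite subrr mul0mx.
  rewrite mulmxBl -!mulmxA YX -!scalemxAr -scalerBr !mulmxA.
  by rewrite EE.
exists m, (m + r)%N, (E *m C'), (H *m E), T, U; split => //.
  by rewrite mulmxA EC'H.
rewrite -mulmxA (mulmxA E) EE -/D -[RHS]hsubmxK [E *m C']mul_mx_row.
rewrite mul_mx_row mulmxA EY HY; congr row_mx.
apply/eqP; rewrite -subr_eq0; apply/eqP/Phireg.
rewrite mulmxBl mulmxN mulNmx.
have -> : lsubmx D *m Phi = - (rsubmx D *m V').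
  by apply/eqP; rewrite -subr_eq0 opprK DU'.
by rewrite opprK -!mulmxA ZPhi (mulmxA E) EY -HY !mulmxA addNr.
Qed.
End StablyFree.

(** * Rings with Weierstrass preparation *)

Lemma common_denominator (A : comNzRingType) (L : fieldType)
    (j : {rmorphism A -> L}) :
  (forall x y : A, x * y = 0 -> (x == 0) || (y == 0)) ->
  (forall z : L, exists2 b, b != 0 & exists a, z * j b = j a) ->
  forall m n (M : 'M[L]_(m, n)), exists2 b, b != 0 &
    exists N, j b *: M = map_mx j N.
Proof.
move=> Aint frac m n M.
have h (p : 'I_m * 'I_n) : exists ba : A * A,
    ba.1 != 0 /\ M p.1 p.2 * j ba.1 = j ba.2.
  by have [b b0 [a ba]] := frac (M p.1 p.2); exists (b, a).
have [s hs] := choice h.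
exists (\prod_p (s p).1).
  elim/big_ind: _ => [|x y x0 y0|p _]; first exact: oner_neq0.
    by apply/eqP => /Aint; rewrite (negPf x0) (negPf y0).
  by have [] := hs p.
exists (\matrix_(i, k) ((s (i, k)).2 * \prod_(p | p != (i, k)) (s p).1)).
apply/matrixP => i k; rewrite !mxE (bigD1 (i, k))//= !rmorphM /=.
by have [_ /= <-] := hs (i, k); rewrite mulrC mulrA.
Qed.

(** Over the fraction field [E] is the product of a column and a row basis;
    [f] is a common denominator. *)
Lemma idempotent_generic (A : comNzRingType) n (E : 'M[A]_n) :
  (forall x y : A, x * y = 0 -> (x == 0) || (y == 0)) -> E *m E = E ->
  exists (r : nat) (f : A) (X : 'M[A]_(r, n)) (Y : 'M[A]_(n, r)),
    [/\ f != 0, X *m Y = f%:M & Y *m X = f *: E].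
Proof.
move=> Aint EE; have [L [j [jinj frac]]] := fraction_field Aint.
pose EL := map_mx j E; pose C := col_base EL; pose R := row_base EL.
have CR : C *m R = EL by apply: mulmx_base.
have [C' C'C] := row_fullP (col_base_full EL : row_full C).
have [R' RR'] := row_freeP (row_base_free EL : row_free R).
clearbody C R.
have RC : R *m C = 1%:M.
  have CRCR : (C *m R) *m (C *m R) = C *m R by rewrite CR -map_mxM EE.
  have := congr1 (fun M => C' *m M *m R') CRCR.
  by rewrite /= !mulmxA C'C !mul1mx -mulmxA RR' mulmx1.
have [b b0 [Y bY]] := common_denominator Aint frac C.
have [c c0 [X cX]] := common_denominator Aint frac R.
have mapj_inj p q : injective (@map_mx A L j p q).
  by move=> M N /matrixP MN; apply/matrixP => i k; have := MN i k; rewrite !mxE => /jinj.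
exists (\rank EL), (c * b), X, Y; split.
- by apply/eqP => /Aint; rewrite (negPf b0) (negPf c0).
- apply: mapj_inj; rewrite map_mxM -bY -cX -scalemxAl -scalemxAr RC scalerA.
  by rewrite map_scalar_mx rmorphM scale_scalar_mx mulr1.
- apply: mapj_inj; rewrite map_mxM -bY -cX -scalemxAl -scalemxAr CR scalerA.
  by rewrite map_mxZ /= rmorphM [j c * _]mulrC.
Qed.

(** The ring [B] and the element [t] vary with [f], as do the variables in which
    a series is prepared. *)
Definition weierstrass_preparable (A : comNzRingType) (f : A) : Prop :=
  exists (B : comNzRingType) (iota : {rmorphism B -> A}) (t : A) (w : {poly B})
    (u v : A),
  [/\ projfree B, weierstrass_division iota t w, u * v = 1 &
      f * u = ev iota t w].

(** A nonzero entry is moved to the front and made of the form w(t), which is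
    the case of [splits_off_weierstrass]. A row of length one has kernel 0. *)
Lemma unimodular_splits_off (A : comNzRingType) :
  (forall x y : A, x * y = 0 -> (x == 0) || (y == 0)) ->
  (forall f : A, f != 0 -> weierstrass_preparable f) ->
  forall m (f : 'rV[A]_m), splits_off f.
Proof.
move=> Aint prep m f g fg.
have [i fi0] : exists i, f 0 i != 0.
  apply: contrapT => nf; have f0 : f = 0.
    apply/rowP => i; rewrite mxE; apply/eqP/negPn/negP => fi; apply: nf.
    by exists i.
  move: fg; rewrite f0 mul0mx => /matrixP/(_ 0 0)/eqP.
  by rewrite !mxE eqxx eq_sym oner_eq0.
case: m => [|[|m]] in f g fg i fi0 *.
- by case: i fi0.
- exists 0%N, 0, 0; split; last by apply/matrixP => -[].
  have -> : g *m f = f *m g.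
    by apply/matrixP => a b; rewrite !mxE !big_ord1 !ord1 mulrC.
  by rewrite fg subrr mul0mx.
suff main (f' : 'rV[A]_(1 + 1 + m)) : f' 0 0 != 0 -> splits_off f'.
  have tpK : tperm_mx 0 i *m tperm_mx 0 i = 1%:M :> 'M[A]_m.+2.
    by rewrite -perm_mxM tperm2 perm_mx1.
  have ff' : row_equiv f (f *m tperm_mx 0 i).
    by exists (tperm_mx 0 i), (tperm_mx 0 i).
  apply: (splits_off_equiv (row_equiv_sym ff')) => //.
  by apply: main; rewrite -xcolE mxE tpermL.
move=> {g fg fi0 i f} f'0.
rewrite -[f']hsubmxK -[lsubmx f' : 'rV_(1 + 1)]hsubmxK.
rewrite [lsubmx (lsubmx f')]mx11_scalar [rsubmx (lsubmx f')]mx11_scalar.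
set F := lsubmx (lsubmx f') 0 0; set G := rsubmx (lsubmx f') 0 0.
set v0 := rsubmx f'.
have F0 : F != 0.
  rewrite /F !mxE; move: f'0; congr (f' 0 _ != 0); exact: val_inj.
have [B [iota [t [w [u [v [Bfree hw uv fu]]]]]]] := prep F F0.
have uvM : (block_mx u%:M 0 0 1%:M : 'M[A]_(1 + 1)) *m
    block_mx v%:M 0 0 1%:M = 1%:M.
  rewrite mulmx_block !(mulmx0, mul0mx, mulmx1, mul1mx, addr0, add0r).
  by rewrite -scalar_mxM uv -scalar_mx_block.
have := row_equiv_diagl (row_mx F%:M G%:M : 'rV_(1 + 1)) v0 uvM.
rewrite mul_row_block !(mulmx0, mulmx1, addr0, add0r) -scalar_mxM fu.
move/row_equiv_sym/splits_off_equiv; apply.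
apply: splits_off_weierstrass => // x y xy.
have := @Aint (iota x) (iota y); rewrite -rmorphM xy rmorph0 => /(_ erefl).
have inj z : (iota z == 0) = (z == 0).
  apply/eqP/eqP => [z0|->]; last by rewrite rmorph0.
  by apply: polyC_inj; apply: (wd_inj hw); rewrite evC.
by rewrite !inj.
Qed.

(** The common denominator of [idempotent_generic] is replaced by w(t). The image
    of [E] is then stably free by [weierstrass_stably_free], and unimodular rows
    over [A] have free kernels. *)
Theorem weierstrass_projfree (A : comNzRingType) :
  (forall f : A, f != 0 -> weierstrass_preparable f) -> projfree A.
Proof.
move=> prep.
have Aint (x y : A) : x * y = 0 -> (x == 0) || (y == 0).
  move=> xy; have [//|x0] := eqVneq x 0; apply/eqP.
  have [B [iota [t [w [u [v [_ hw _ xu]]]]]]] := prep x x0.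
  by apply: (wd_reg hw); rewrite -xu mulrA [y * x]mulrC xy mul0r.
have herm := unimodular_splits_off Aint prep.
move=> n E EE; have [r [f [X [Y [f0 XY YX]]]]] := idempotent_generic Aint EE.
have freg p q (M N : 'M[A]_(p, q)) : f *: M = f *: N -> M = N.
  move=> /matrixP MN; apply/matrixP => i j; have := MN i j; rewrite !mxE.
  move=> /eqP; rewrite -subr_eq0 -mulrBr => /eqP/Aint; rewrite (negPf f0) /=.
  by rewrite subr_eq0 => /eqP.
have EY : E *m Y = Y.
  by apply: freg; rewrite scalemxAl -YX -mulmxA XY mul_mx_scalar.
have [B [iota [t [w [u [v [Bfree hw uv fu]]]]]]] := prep f f0.
have uXY : (u *: X) *m Y = (ev iota t w)%:M.
  by rewrite -scalemxAl XY scale_scalar_mx mulrC fu.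
have YuX : Y *m (u *: X) = ev iota t w *: E.
  by rewrite -scalemxAr YX scalerA mulrC fu.
have [m [k [H [C [U [T [UT HC CH]]]]]]] :=
  weierstrass_stably_free hw Bfree uXY YuX Aint EE EY.
exact: (stably_free_splits herm EE UT HC CH).
Qed.

(** * The Gauss norm and successive approximation *)

Lemma geometric_small (R : realType) (C e eps : R) : 0 < C -> 0 < e ->
  0 < eps -> eps < 1 -> exists m : nat, C * eps ^+ m < e.
Proof.
move=> C0 e0 eps0 eps1.
pose del := eps^-1 - 1.
have del0 : 0 < del by rewrite subr_gt0 invf_gt1.
have bern m : m%:R * del <= eps^-1 ^+ m.
  have eE : eps^-1 = 1 + del by rewrite addrC subrK.
  suff h : 1 + m%:R * del <= eps^-1 ^+ m by apply: le_trans h; rewrite lerDr.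
  elim: m => [|m IH]; first by rewrite mul0r addr0 expr0.
  rewrite exprS; apply: (@le_trans _ _ (eps^-1 * (1 + m%:R * del))).
    have : 0 <= m%:R * del * del by rewrite !mulr_ge0// ltW.
    rewrite eE -natr1; lra.
  by rewrite ler_pM2l ?invr_gt0.
pose m := Num.bound (C / e / del).
exists m.
have hm : C / e / del < m%:R.
  by apply: le_lt_trans (archi_boundP _) => //; rewrite !divr_ge0 ?ltW.
rewrite -ltr_pdivlMr ?exprn_gt0// -exprVn.
rewrite ltr_pdivrMr// in hm; rewrite ltr_pdivrMr// in hm.
apply: lt_le_trans hm _; rewrite mulrC ler_pM2l//; exact: bern.
Qed.

Section Norm.
Context {R : realType} {K : completeNonarchFieldType R} {n : nat}.
Variable rho : 'I_n -> {posnum R}.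
Notation A := (laurent K rho).
Notation rp := (rpow rho).
Implicit Types (f g q r a : A) (M N e eps : R).

(** A bound for the Gauss norm; working with bounds avoids the supremum that
    defines it. *)
Definition bnd f M : Prop := forall i, absv (f i) * rp i <= M.

Lemma wt_ge0 f i : 0 <= absv (f i) * rp i.
Proof. by rewrite mulr_ge0 ?absv_ge0// ltW// rpow_gt0. Qed.

Lemma wt_le (x : K) i M : (absv x * rp i <= M) = (absv x <= M / rp i).
Proof. by rewrite ler_pdivlMr// rpow_gt0. Qed.

Lemma bnd_le f M N : M <= N -> bnd f M -> bnd f N.
Proof. by move=> MN h i; apply: le_trans (h i) MN. Qed.

Lemma bndD f g M : bnd f M -> bnd g M -> bnd (f + g) M.
Proof. by move=> hf hg i; rewrite wt_le absvD_le// -wt_le. Qed.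

Lemma bndN f M : bnd f M -> bnd (- f) M.
Proof. by move=> hf i; rewrite absvN. Qed.

Lemma bndB f g M : bnd f M -> bnd g M -> bnd (f - g) M.
Proof. by move=> hf /bndN; apply: bndD. Qed.

Lemma bnd0 M : 0 <= M -> bnd 0 M.
Proof. by move=> M0 i; rewrite absv0 mul0r. Qed.

Lemma bnd1 : bnd 1 1.
Proof.
move=> i /=; have [->|_] := eqVneq i 0; last by rewrite absv0 mul0r.
by rewrite absv1 mul1r /rpow big1// => k _; rewrite ffunE expr0z.
Qed.

Lemma bndM f g M N : 0 < M -> 0 < N -> bnd f M -> bnd g N -> bnd (f * g) (M * N).
Proof.
move=> M0 N0 hf hg k; rewrite wt_le; apply: (hassum_le _ (coef_mul f g k)).
  by rewrite divr_gt0 ?mulr_gt0 ?rpow_gt0.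
move=> i; rewrite -wt_le absvM.
have -> : rp k = rp i * rp (k - i) by rewrite -rpowD subrKC.
by rewrite mulrACA ler_pM ?wt_ge0.
Qed.

Lemma bnd_exists f : exists2 M, 0 < M & bnd f M.
Proof. exact: laurent_bound. Qed.

Lemma bnd_eq0 f : (forall e, 0 < e -> bnd f e) -> f = 0.
Proof.
move=> h; apply: laurent_eq => i /=; apply: absv_le_eq => e e0; rewrite subr0.
have /h/(_ i) : 0 < e * rp i by rewrite mulr_gt0 ?rpow_gt0.
by rewrite ler_pM2r ?rpow_gt0.
Qed.

(** The limit is taken coefficient by coefficient; uniformity of the estimates
    keeps its coefficients null at infinity. *)
Lemma bnd_complete (a : nat -> A) (C eps : R) : 0 < C -> 0 < eps -> eps < 1 ->
  (forall m m', (m <= m')%N -> bnd (a m' - a m) (C * eps ^+ m)) ->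
  exists l, forall m, bnd (l - a m) (C * eps ^+ m).
Proof.
move=> C0 eps0 eps1 ha.
have pos m : 0 < C * eps ^+ m by rewrite mulr_gt0 ?exprn_gt0.
have cv i : exists l, forall e, 0 < e -> exists N : nat, forall m, (N <= m)%N ->
    absv (a m i - l) < e.
  apply: absv_complete => e e0.
  have [N hN] : exists N : nat, C * eps ^+ N < e * rp i.
    by apply: geometric_small => //; rewrite mulr_gt0 ?rpow_gt0.
  exists N => m m' Nm Nm'.
  have h j : (N <= j)%N -> absv (a j i - a N i) < e.
    move=> Nj; have := ha _ _ Nj i; rewrite /= => /le_lt_trans/(_ hN).
    by rewrite ltr_pM2r ?rpow_gt0.
  have -> : a m i - a m' i = (a m i - a N i) - (a m' i - a N i) by ring.
  by apply: absvD_lt; rewrite ?absvN; apply: h.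
have [l hl] := choice cv.
have la m i : absv (l i - a m i) * rp i <= C * eps ^+ m.
  rewrite wt_le; have [|N hN] := hl i (C * eps ^+ m / rp i).
    by rewrite divr_gt0 ?rpow_gt0.
  rewrite -(subrKA (a (maxn N m) i)); apply: absvD_le.
    by rewrite absv_distC ltW// hN// leq_maxl.
  by rewrite -wt_le; have := ha m _ (leq_maxr N m) i.
have lnull : null_coef rho l.
  move=> e e0; have [m hm] := geometric_small C0 e0 eps0 eps1.
  have [N hN] := coefP (a m) e0; exists N => i /hN ami.
  have -> : l i = (l i - a m i) + a m i by ring.
  rewrite -ltr_pdivlMr ?rpow_gt0//; apply: absvD_lt; rewrite ltr_pdivlMr ?rpow_gt0//.
  exact: le_lt_trans (la m i) hm.
by exists (Laurent lnull) => m i /=; apply: la.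
Qed.

(** Approximate division with an error smaller by the factor [eps] is iterated
    on the error; quotients and remainders add up to convergent series. The
    remainders are confined to the exponents in [P]. *)
Lemma successive_division f (P : multiexp n -> Prop) F eps :
  0 < F -> 0 < eps -> eps < 1 -> bnd f F ->
  (forall a M, 0 < M -> bnd a M -> exists q r,
     [/\ bnd q (M / F), bnd r M, forall i, ~ P i -> r i = 0 &
         bnd (a - (q * f + r)) (M * eps)]) ->
  forall a M, 0 < M -> bnd a M -> exists q r,
     [/\ bnd q (M / F), bnd r M, forall i, ~ P i -> r i = 0 & a = q * f + r].
Proof.
move=> F0 eps0 eps1 fF step a M M0 aM.
have step' (p : A * R) : exists qr : A * A, 0 < p.2 -> bnd p.1 p.2 ->
     [/\ bnd qr.1 (p.2 / F), bnd qr.2 p.2, forall i, ~ P i -> qr.2 i = 0 &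
         bnd (p.1 - (qr.1 * f + qr.2)) (p.2 * eps)].
  have [[p0 bp]|np] := pselect (0 < p.2 /\ bnd p.1 p.2).
    by have [q [r h]] := step _ _ p0 bp; exists (q, r).
  by exists (0, 0) => p0 bp; case: np.
have [s hs] := choice step'.
pose res (qr : A * A) := a - (qr.1 * f + qr.2).
pose next (k : nat) (qr : A * A) := qr + s (res qr, M * eps ^+ k).
pose st := nat_rect (fun=> (A * A)%type) 0 next.
have pos m : 0 < M * eps ^+ m by rewrite mulr_gt0 ?exprn_gt0.
have inv k : bnd (res (st k)) (M * eps ^+ k) /\ forall i, ~ P i -> (st k).2 i = 0.
  elim: k => [|k [bk sk]].
    by rewrite /res /= mul0r addr0 subr0 expr0 mulr1.
  have [_ _ s0 bk'] := hs (res (st k), M * eps ^+ k) (pos k) bk.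
  split; last by move=> i nPi; rewrite /= sk// s0// addr0.
  rewrite exprSr mulrA; move: bk' => /=; congr bnd.
  by rewrite /res /next /=; ring.
have stS k : bnd ((st k.+1).1 - (st k).1) (M / F * eps ^+ k) /\
    bnd ((st k.+1).2 - (st k).2) (M * eps ^+ k).
  have [h1 h2 _ _] := hs (res (st k), M * eps ^+ k) (pos k) (inv k).1.
  by split; rewrite /= addrC addKr// mulrAC.
have cauchy (x : nat -> A) C : 0 < C ->
    (forall k, bnd (x k.+1 - x k) (C * eps ^+ k)) ->
    forall m m', (m <= m')%N -> bnd (x m' - x m) (C * eps ^+ m).
  move=> C0 hx m m' /subnKC <-; elim: (m' - m)%N => [|k IH].
    by rewrite addn0 subrr; apply: bnd0; rewrite ltW// mulr_gt0 ?exprn_gt0.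
  rewrite addnS -(subrKA (x (m + k)%N)); apply: bndD => //.
  apply: bnd_le (hx _); rewrite ler_pM2l// exprD ler_piMr ?exprn_ge0 ?(ltW eps0)//.
  by rewrite exprn_ile1 ?(ltW eps0) ?(ltW eps1).
have MF0 : 0 < M / F by rewrite divr_gt0.
have [q hq] := bnd_complete MF0 eps0 eps1 (cauchy _ _ MF0 (fun k => (stS k).1)).
have [r hr] := bnd_complete M0 eps0 eps1 (cauchy _ _ M0 (fun k => (stS k).2)).
exists q, r; split.
- by have := hq 0%N; rewrite /= subr0 expr0 mulr1.
- by have := hr 0%N; rewrite /= subr0 expr0 mulr1.
- move=> i nPi; apply: absv_le_eq => e e0; rewrite subr0.
  have [m hm] : exists m : nat, M * eps ^+ m < e * rp i.
    by apply: geometric_small => //; rewrite mulr_gt0 ?rpow_gt0.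
  have := hr m i; rewrite /= (inv m).2// subr0 => /le_lt_trans/(_ hm).
  by rewrite ltr_pM2r ?rpow_gt0// => /ltW.
- apply/eqP; rewrite -subr_eq0; apply/eqP/bnd_eq0 => e e0.
  have [m hm] := geometric_small M0 e0 eps0 eps1.
  have -> : a - (q * f + r) =
      res (st m) - ((q - (st m).1) * f + (r - (st m).2)).
    by rewrite /res; ring.
  apply: bnd_le (ltW hm) _; apply: bndB; first exact: (inv m).1.
  apply: bndD; last exact: hr.
  have -> : M * eps ^+ m = M / F * eps ^+ m * F.
    by rewrite mulrAC divfK// gt_eqF.
  by apply: bndM => //; rewrite mulr_gt0 ?exprn_gt0.
Qed.

(** The geometric series, obtained as the division of 1 by 1 + q with zero
    remainder. *)
Lemma bnd_unit q eps : 0 < eps -> eps < 1 -> bnd q eps ->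
  exists v, (1 + q) * v = 1.
Proof.
move=> eps0 eps1 hq.
have f1 : bnd (1 + q) 1 by apply: bndD (bnd1) (bnd_le (ltW eps1) hq).
have [|v [r [_ _ r0 E]]] := @successive_division (1 + q) (fun=> False) 1 eps
    ltr01 eps0 eps1 f1 _ 1 1 ltr01 bnd1.
  move=> a M M0 aM; exists a, 0; rewrite divr1; split => //.
    by apply: bnd0; apply: ltW.
  have -> : a - (a * (1 + q) + 0) = - (a * q) by ring.
  by apply/bndN/bndM.
have r_0 : r = 0 by apply: laurent_eq => i; rewrite r0.
by exists v; rewrite mulrC [RHS]E r_0 addr0.
Qed.

Definition mono_coef (c : K) (s i : multiexp n) : K := if i == s then c else 0.

Lemma mono_null c s : null_coef rho (mono_coef c s).
Proof.
apply/null_coefP => e e0; exists [:: s] => i; rewrite inE /mono_coef => /negPf ->.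
by rewrite absv0 mul0r ltW.
Qed.

Definition mono c s : A := Laurent (mono_null c s).

Lemma monoE c s i : mono c s i = if i == s then c else 0.
Proof. by []. Qed.

Lemma coef_monoM c s g i : (mono c s * g) i = c * g (i - s).
Proof.
have := hassum1 (u := fun j => mono c s j * g (i - j)) (i0 := s).
rewrite monoE eqxx => h; apply: (hassum_uniq (coef_mul _ _ _)); apply: h => j.
by rewrite monoE => /negPf ->; rewrite mul0r.
Qed.

Lemma monoM c d s t : mono c s * mono d t = mono (c * d) (s + t).
Proof.
apply: laurent_eq => i; rewrite coef_monoM !monoE subr_eq [t + s]addrC.
by case: ifP; rewrite ?mulr0.
Qed.

Lemma mono1 : mono 1 0 = 1.
Proof. by apply: laurent_eq => i; rewrite monoE /=; case: eqP. Qed.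

Lemma bnd_mono c s M : 0 <= M -> absv c * rp s <= M -> bnd (mono c s) M.
Proof.
by move=> M0 h i; rewrite monoE; case: eqP => [->//|_]; rewrite absv0 mul0r.
Qed.

Lemma laurent_addE f g i : (f + g) i = f i + g i.
Proof. by []. Qed.

Lemma laurent_sumE (I : Type) (s : seq I) (u : I -> A) i :
  (\sum_(x <- s) u x) i = \sum_(x <- s) u x i.
Proof. by elim/big_rec2: _ => // x y z _ <-. Qed.

Lemma truncate f e : 0 < e -> exists2 s : seq (multiexp n), uniq s &
  bnd (f - \sum_(i <- s) mono (f i) i) e.
Proof.
move=> e0; have [s hs] := (null_coefP rho f).1 (coefP f) e e0.
exists (undup s); first exact: undup_uniq.
move=> i /=; rewrite laurent_sumE.
under eq_bigr do rewrite monoE.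
have [is_|nis] := boolP (i \in undup s).
  rewrite (bigD1_seq i)//= ?undup_uniq// eqxx big1 ?addr0 ?subrr ?absv0 ?mul0r ?ltW//.
  by move=> j; rewrite eq_sym => /negPf ->.
rewrite big_seq big1 ?subr0; first by apply: hs; rewrite -mem_undup.
by move=> j js; case: eqP => // ij; move: nis; rewrite ij js.
Qed.
End Norm.

(** * Laurent series in one distinguished variable *)

Lemma hassum_extend (R : realType) (K : completeNonarchFieldType R)
    (I J : choiceType) (u : I -> K) l (phi : J -> I) (psi : I -> J) :
  cancel phi psi -> (forall i, u i != 0 -> phi (psi i) = i) ->
  hassum (u \o phi) l -> hassum u l.
Proof.
move=> phiK supp hu e e0; have [s hs] := hu e e0.
exists (map phi s) => t ut st.
pose t' := [seq psi i | i <- t & phi (psi i) == i].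
have -> : \sum_(i <- t) u i = \sum_(j <- t') (u \o phi) j.
  rewrite big_map big_filter [LHS](bigID (fun i => phi (psi i) == i)) /=.
  rewrite [X in _ + X]big1 ?addr0; last first.
    by move=> i; apply: contraNeq => /supp ->.
  by apply: eq_bigr => i /eqP ->.
apply: hs.
  rewrite map_inj_in_uniq ?filter_uniq// => i j; rewrite !mem_filter.
  by move=> /andP[/eqP hi _] /andP[/eqP hj _] eq; rewrite -hi -hj eq.
move=> j js; apply/mapP; exists (phi j); last by rewrite phiK.
by rewrite mem_filter phiK eqxx st// map_f.
Qed.

Section Slices.
Context {R : realType} {K : completeNonarchFieldType R} {n : nat}.
Variables (rho : 'I_n.+1 -> {posnum R}) (c : 'I_n -> int).
Implicit Types (i : multiexp n.+1) (j : multiexp n) (k : int).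

(** After the substitution t_b := t_b t_0^(c_b) for b > 0, the monomial of
    exponent [i] has degree [height i] in t_0, and [tailexp i] in the other
    variables. [expon] recovers an exponent from these data. *)
Definition height i : int := i ord0 + \sum_b c b * i (lift ord0 b).
Definition tailexp i : multiexp n := [ffun b => i (lift ord0 b)].
Definition expon j k : multiexp n.+1 :=
  [ffun a => if unlift ord0 a is Some b then j b else k - \sum_b c b * j b].

Lemma expon_lift j k b : expon j k (lift ord0 b) = j b.
Proof. by rewrite ffunE liftK. Qed.

Lemma expon_ord0 j k : expon j k ord0 = k - \sum_b c b * j b.
Proof. by rewrite ffunE unlift_none. Qed.

Lemma heightD i i' : height (i + i') = height i + height i'.
Proof.
rewrite /height ffunE; under eq_bigr do rewrite ffunE mulrDr.
by rewrite big_split /=; ring.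
Qed.

Lemma height0 : height 0 = 0.
Proof. by apply: (@addrI _ (height 0)); rewrite -heightD !addr0. Qed.

Lemma heightB i i' : height (i - i') = height i - height i'.
Proof. by apply/eqP; rewrite eq_sym subr_eq -heightD subrK. Qed.

Lemma height_expon j k : height (expon j k) = k.
Proof.
rewrite /height expon_ord0; under [X in _ + X]eq_bigr do rewrite expon_lift.
by rewrite subrK.
Qed.

Lemma tailexp_expon j k : tailexp (expon j k) = j.
Proof. by apply/ffunP => b; rewrite ffunE expon_lift. Qed.

Lemma expon_height i : expon (tailexp i) (height i) = i.
Proof.
apply/ffunP => a; rewrite ffunE; case: unliftP => [b ->|->]; first by rewrite ffunE.
have E b : c b * tailexp i b = c b * i (lift ord0 b) by rewrite ffunE.
by rewrite (eq_bigr _ (fun b _ => E b)) addrK.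
Qed.

Lemma exponD j j' k k' : expon (j + j') (k + k') = expon j k + expon j' k'.
Proof.
apply/ffunP => a; rewrite !ffunE; case: unliftP => [b _|_]; first by rewrite !ffunE.
under eq_bigr do rewrite ffunE mulrDr.
by rewrite big_split /=; ring.
Qed.

Lemma tailexpB i i' : tailexp (i - i') = tailexp i - tailexp i'.
Proof. by apply/ffunP => b; rewrite !ffunE. Qed.

Lemma slice_radius_gt0 b :
  0 < (rho (lift ord0 b))%:num * (rho ord0)%:num ^ (- c b).
Proof. by rewrite mulr_gt0// exprz_gt0. Qed.

(** The radius of t_b t_0^(- c_b); with it, series of height 0 are Laurent series
    in the remaining variables. *)
Definition slice_radius b : {posnum R} := PosNum (slice_radius_gt0 b).

Lemma rpow_expon j k :
  rpow rho (expon j k) = rpow slice_radius j * (rho ord0)%:num ^ k.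
Proof.
have r0 : (rho ord0)%:num != 0 by rewrite gt_eqF.
rewrite /rpow big_ord_recl expon_ord0.
under [X in _ * X = _]eq_bigr do rewrite expon_lift.
under [in RHS]eq_bigr do rewrite /= expfzMl exprz_exp mulNr.
rewrite big_split /= -mulrA mulrC; congr (_ * _).
rewrite expfzDr// mulrC; congr (_ * _).
rewrite -sumrN.
exact: (big_morph (fun z => (rho ord0)%:num ^ z) (fun x y => expfzDr x y r0) (expr0z _)).
Qed.

Notation A := (laurent K rho).
Notation B := (laurent K slice_radius).

Lemma slice_null (a : A) k : null_coef slice_radius (fun j => a (expon j k)).
Proof.
have rk : 0 < (rho ord0)%:num ^ k by rewrite exprz_gt0.
apply/null_coefP => e e0.
have [|s hs] := (null_coefP rho a).1 (coefP a) (e * (rho ord0)%:num ^ k).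
  by rewrite mulr_gt0.
exists (map tailexp s) => j js.
rewrite -(ler_pM2r rk) -mulrA -rpow_expon; apply: hs.
by apply: contra js => h; apply/mapP; exists (expon j k); rewrite ?tailexp_expon.
Qed.

Definition slice (a : A) k : B := Laurent (slice_null a k).

Definition embed_coef (b : B) i : K := if height i == 0 then b (tailexp i) else 0.

Lemma embed_null (b : B) : null_coef rho (embed_coef b).
Proof.
apply/null_coefP => e e0.
have [s hs] := (null_coefP slice_radius b).1 (coefP b) e e0.
exists [seq expon j 0 | j <- s] => i is_; rewrite /embed_coef.
have [h0|_] := eqVneq (height i) 0; last by rewrite absv0 mul0r ltW.
rewrite -{2}(expon_height i) h0 rpow_expon expr0z mulr1; apply: hs.
apply: contra is_ => h; apply/mapP; exists (tailexp i) => //.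
by rewrite -h0 expon_height.
Qed.

Definition embed (b : B) : A := Laurent (embed_null b).

Lemma embedE b i : embed b i = if height i == 0 then b (tailexp i) else 0.
Proof. by []. Qed.

Lemma embed_zmod : zmod_morphism embed.
Proof.
move=> b b'; apply: laurent_eq => i; rewrite /= /embed_coef.
by case: ifP; rewrite ?subr0.
Qed.

Lemma embed_monoid : monoid_morphism embed.
Proof.
split.
  apply: laurent_eq => i; rewrite /= /embed_coef /=.
  have [->|i0] := eqVneq i 0.
    rewrite height0 eqxx; have -> : tailexp 0 = 0 by apply/ffunP => b; rewrite !ffunE.
    by rewrite eqxx.
  have [h0|//] := eqVneq (height i) 0; have [t0|//] := eqVneq (tailexp i) 0.
  case/negP: i0; rewrite -(expon_height i) h0 t0; apply/eqP/ffunP => a.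
  rewrite !ffunE; case: unliftP => [b _|_]; first by rewrite ffunE.
  by rewrite big1 ?subr0// => b _; rewrite ffunE mulr0.
move=> b b'; apply: laurent_eq => k; symmetry.
apply: (hassum_uniq (coef_mul (embed b) (embed b') k)).
rewrite embedE; have [h0|h0] := eqVneq (height k) 0.
  apply: (@hassum_extend _ _ _ _ _ _ (expon ^~ 0) tailexp).
  - by move=> j; rewrite tailexp_expon.
  - move=> i; rewrite !embedE; have [hi _|] := eqVneq (height i) 0.
      by rewrite -hi expon_height.
    by rewrite mul0r eqxx.
  - have := coef_mul b b' (tailexp k); congr hassum; apply/funext => j /=.
    rewrite /embed_coef height_expon eqxx heightB height_expon h0 subrr eqxx.
    by rewrite tailexpB !tailexp_expon.
have -> : (fun i => embed b i * embed b' (k - i)) = fun=> 0.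
  apply/funext => i; rewrite !embedE heightB.
  by have [->|] := eqVneq (height i) 0; rewrite ?mul0r// subr0 (negPf h0) mulr0.
by have := @hassum1 R K (multiexp n.+1) (fun=> 0) 0; apply.
Qed.

HB.instance Definition _ := GRing.isZmodMorphism.Build B A embed embed_zmod.
HB.instance Definition _ := GRing.isMonoidMorphism.Build B A embed embed_monoid.

Definition tvar : A := mono rho 1 (expon 0 1).

Lemma tvarX (k : nat) : tvar ^+ k = mono rho 1 (expon 0 k%:Z).
Proof.
elim: k => [|k IH].
  rewrite expr0 -mono1; congr mono; rewrite -{1}[0](expon_height 0) height0.
  by congr expon; apply/ffunP => b; rewrite !ffunE.
rewrite exprS IH monoM mulr1 -exponD add0r.
by congr (mono _ _ (expon _ _)); rewrite -PoszD.
Qed.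

Notation evt := (ev (embed : {rmorphism B -> A}) tvar).

Lemma coef_ev p i : evt p i =
  if 0 <= height i then p`_(absz (height i)) (tailexp i) else 0.
Proof.
rewrite (ev_wide _ _ (leqnn _)) laurent_sumE.
have E (k : 'I_(size p)) : (embed p`_k * tvar ^+ k) i =
    if height i == k%:Z then p`_k (tailexp i) else 0.
  rewrite tvarX mulrC coef_monoM mul1r embedE heightB height_expon subr_eq0.
  by rewrite tailexpB tailexp_expon subr0.
rewrite (eq_bigr _ (fun m _ => E m)); case: ifP => hi; last first.
  by rewrite big1// => m _; case: eqP => // hk; move: hi; rewrite hk.
have [lt|ge] := ltnP `|height i|%N (size p).
  rewrite (bigD1 (Ordinal lt))//= gez0_abs// eqxx big1 ?addr0// => m.
  rewrite -val_eqE /= => mne; case: eqP => // hk.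
  by move: mne; rewrite hk eqxx.
rewrite nth_default// big1// => m _; case: eqP => // hk.
by move: ge; rewrite hk /= leqNgt ltn_ord.
Qed.

Lemma ev_inj p : evt p = 0 -> p = 0.
Proof.
move=> p0; apply/polyP => k; rewrite coef0; apply: laurent_eq => j /=.
have := congr1 (fun a : A => a (expon j k%:Z)) p0.
by rewrite /= coef_ev height_expon tailexp_expon.
Qed.

Definition slice_poly d (a : A) : {poly B} := \poly_(k < d) slice a k%:Z.

Lemma ev_slice_poly d (a : A) :
  (forall i, ~ (0 <= height i < d%:Z) -> a i = 0) -> evt (slice_poly d a) = a.
Proof.
move=> ha; apply: laurent_eq => i; rewrite coef_ev coef_poly.
case: ifP => hi; last by rewrite ha// hi.
case: ltnP => hd; first by rewrite /= gez0_abs// expon_height.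
rewrite ha// hi /= -(gez0_abs hi) ltz_nat => h.
by move: hd; rewrite leqNgt h.
Qed.
End Slices.

(** * Weierstrass division of Laurent series *)

Lemma lt_gap (R : realType) (T : eqType) (s : seq T) (v : T -> R) N : 0 < N ->
  (forall x, x \in s -> v x < N) ->
  exists eps, [/\ 0 < eps, eps < 1 & forall x, x \in s -> v x <= N * eps].
Proof.
move=> N0; elim: s => [|y s IH] hs.
  by exists (1 / 2); split => //; lra.
have [|e [e0 e1 he]] := IH; first by move=> x xs; apply: hs; rewrite inE xs orbT.
exists (Num.max e (v y / N)); split.
- by rewrite lt_max e0.
- by rewrite gt_max e1 ltr_pdivrMr// mul1r hs// inE eqxx.
move=> x; rewrite inE => /predU1P[->|/he h].
  by rewrite mulrC -ler_pdivrMr// le_max lexx orbT.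
by apply: le_trans h _; rewrite ler_pM2l// le_max lexx.
Qed.

Lemma seq_max d (T : eqType) (O : orderType d) (s : seq T) (v : T -> O) y :
  y \in s -> exists2 x, x \in s & forall z, z \in s -> (v z <= v x)%O.
Proof.
elim: s y => // a [|b s] IH y _.
  by exists a => [|z]; rewrite ?mem_head// inE => /eqP ->.
have [x xs hx] := IH b (mem_head _ _).
have [ax|xa] := leP (v a) (v x).
  by exists x => [|z]; rewrite inE ?xs ?orbT// => /predU1P[->//|]; apply: hx.
exists a => [|z]; first exact: mem_head.
rewrite inE => /predU1P[->//|/hx h]; exact: le_trans h (ltW xa).
Qed.

Section Dominant.
Context {R : realType} {K : completeNonarchFieldType R} {n : nat}.
Variable rho : 'I_n -> {posnum R}.
Notation A := (laurent K rho).
Notation rp := (rpow rho).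

(** [S] collects the terms of maximal norm. The uniform gap [eps] to the other
    terms is what makes successive approximation converge. *)
Definition dominant (f : A) (S : seq (multiexp n)) (F eps : R) : Prop :=
  [/\ 0 < F, 0 < eps, eps < 1, uniq S & [/\
  forall s, s \in S -> absv (f s) * rp s = F &
  forall s, s \notin S -> absv (f s) * rp s <= F * eps]].

Lemma dominant_exists (f : A) : f != 0 ->
  exists S F eps s0, dominant f S F eps /\ s0 \in S.
Proof.
move=> f0; have [i0 fi0] : exists i, f i != 0.
  apply: contrapT => nf; case/eqP: f0; apply: laurent_eq => i /=.
  by apply/eqP/negPn/negP => fi; apply: nf; exists i.
pose v i := absv (f i) * rp i.
have v0 : 0 < v i0.
  rewrite mulr_gt0 ?rpow_gt0// lt_def absv_ge0 andbT.
  by apply: contra fi0 => /eqP/absv_eq0 ->.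
have [|s hs] := (null_coefP rho f).1 (coefP f) (v i0 / 2); first by rewrite divr_gt0.
have i0s : i0 \in s.
  apply/negPn/negP => /hs; rewrite -/(v i0) => h.
  by move: v0 h; set x := v i0; lra.
have [x xs hx] := seq_max v i0s.
have vx0 : 0 < v x by apply: lt_le_trans v0 (hx _ i0s).
have [|e [e0 e1 he]] := @lt_gap R _ [seq i <- s | v i != v x] v (v x) vx0.
  by move=> y; rewrite mem_filter lt_neqAle => /andP[-> /hx ->].
exists (undup [seq i <- s | v i == v x]), (v x), (Num.max e (1 / 2)), x.
split; last by rewrite mem_undup mem_filter eqxx xs.
split => //.
- by rewrite lt_max e0.
- by rewrite gt_max e1 /=; lra.
- exact: undup_uniq.
split=> i; rewrite mem_undup mem_filter; first by case/andP => /eqP.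
rewrite negb_and -/(v i).
have [is_|/hs vi _] := boolP (i \in s).
  rewrite orbF => vi; apply: le_trans (he i _) _; first by rewrite mem_filter vi.
  by rewrite ler_pM2l// le_max lexx.
apply: le_trans vi _; apply: (@le_trans _ _ (v x * (1 / 2))).
  by have := hx _ i0s; set z := v x; set y := v i0; lra.
by rewrite ler_pM2l// le_max lexx orbT.
Qed.

Lemma dominant_bnd (f : A) S F eps : dominant f S F eps -> bnd f F.
Proof.
case=> F0 e0 e1 _ [h1 h2] i; have [/h1 ->//|/h2 h] := boolP (i \in S).
by apply: le_trans h _; rewrite ler_piMr// ltW.
Qed.

Definition dominant_part (f : A) (S : seq (multiexp n)) : A :=
  \sum_(s <- S) mono rho (f s) s.

Lemma dominant_partE (f : A) S i : uniq S ->
  dominant_part f S i = if i \in S then f i else 0.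
Proof.
move=> uS; rewrite laurent_sumE; under eq_bigr do rewrite monoE.
have [is_|nis] := boolP (i \in S).
  rewrite (bigD1_seq i)//= eqxx big1 ?addr0// => j.
  by rewrite eq_sym => /negPf ->.
rewrite big_seq big1// => j js; case: eqP => // ij.
by move: nis; rewrite ij js.
Qed.

Lemma dominant_part_bnd (f : A) S F eps : dominant f S F eps ->
  bnd (f - dominant_part f S) (F * eps).
Proof.
move=> [F0 e0 e1 uS [_ h2]] i.
rewrite (_ : (f - _) i = f i - dominant_part f S i)// dominant_partE//.
case: ifPn => [_|/h2 h]; last by rewrite subr0.
by rewrite subrr absv0 mul0r mulr_ge0 ?ltW.
Qed.

(** If y + x can be written only once as a sum of dominant exponents of q and f,
    the product of these two terms dominates the coefficient of q f there. *)
Lemma coefM_extremal (f q : A) S F eps T N del x y :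
  dominant f S F eps -> dominant q T N del -> x \in S -> y \in T ->
  (forall s, s \in S -> s != x -> y + x - s \notin T) ->
  (q * f) (y + x) != 0.
Proof.
move=> df dq xS yT hST; apply/eqP => k0.
have [F0 e0 e1 uS [SF SnF]] := df; have [N0 del0 del1 uT [TN TnN]] := dq.
pose g := Num.max eps del.
have g1 : g < 1 by rewrite gt_max e1.
have FN0 : 0 < F * N by rewrite mulr_gt0.
pose f0 := dominant_part f S.
have qf : q * f = q * (f - f0) + \sum_(s <- S) mono rho (f s) s * q.
  by rewrite -mulr_suml -/f0 [f0 * q]mulrC -mulrDr subrK.
have h1 : absv ((q * (f - f0)) (y + x)) * rp (y + x) <= F * N * g.
  have := bndM N0 _ (dominant_bnd dq) (dominant_part_bnd df).
  rewrite mulr_gt0// => /(_ isT)/(_ (y + x))/le_trans; apply.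
  have -> : F * N * g = N * (F * g) by ring.
  by rewrite !ler_pM2l// le_max lexx.
have E : (q * f) (y + x) = f x * q y + ((q * (f - f0)) (y + x) +
   \sum_(s <- S | s != x) f s * q (y + x - s)).
  rewrite {1}qf laurent_addE laurent_sumE; under eq_bigr do rewrite coef_monoM.
  by rewrite (bigD1_seq x)//= addrK; ring.
have h2 : absv (f x * q y) * rp (y + x) = F * N.
  by rewrite absvM rpowD [rp y * _]mulrC mulrACA SF// TN.
have h3 : absv (f x * q y) * rp (y + x) <= F * N * g.
  have -> : f x * q y = - ((q * (f - f0)) (y + x) +
      \sum_(s <- S | s != x) f s * q (y + x - s)).
    by apply/eqP; rewrite -subr_eq0 opprK -E k0.
  rewrite absvN wt_le; apply: absvD_le; first by rewrite -wt_le.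
  rewrite -big_filter; apply: absv_sum => [|s].
    rewrite divr_ge0 ?(ltW (rpow_gt0 _ _))// mulr_ge0 ?(ltW FN0)// le_max.
    by rewrite (ltW e0).
  rewrite mem_filter => /andP[sx sS].
  rewrite -wt_le absvM.
  have -> : rp (y + x) = rp s * rp (y + x - s) by rewrite -rpowD subrKC.
  rewrite mulrACA SF// -mulrA ler_pM2l//.
  apply: le_trans (TnN _ (hST s sS sx)) _.
  by rewrite ler_pM2l// le_max lexx orbT.
move: h3; rewrite h2 -{1}[F * N]mulr1 ler_pM2l// => /(lt_le_trans g1).
by rewrite ltxx.
Qed.
End Dominant.

Section Division.
Context {R : realType} {K : completeNonarchFieldType R} {n : nat}.
Variables (rho : 'I_n.+1 -> {posnum R}) (c : 'I_n -> int).
Notation A := (laurent K rho).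
Notation B := (laurent K (slice_radius rho c)).
Notation rp := (rpow rho).
Notation ht := (height c).
Variables (f : A) (S : seq (multiexp n.+1)) (F eps : R) (d : nat).
Variables (top bot : multiexp n.+1).
Hypotheses (df : dominant f S F eps) (topS : top \in S) (botS : bot \in S).
Hypotheses (ht_top : ht top = d%:Z) (ht_bot : ht bot = 0).
Hypothesis S_top : forall s, s \in S -> s != top -> ht s < d%:Z.
Hypothesis S_bot : forall s, s \in S -> s != bot -> 0 < ht s.

Let f0 := dominant_part f S.
(* The remainders: polynomials in the distinguished variable, of degree < d. *)
Let low (r : A) := forall i, ~ (0 <= ht i < d%:Z) -> r i = 0.

Let F0 : 0 < F. Proof. by case: df. Qed.

Let S_range s : s \in S -> 0 <= ht s <= d%:Z.
Proof.
move=> sS; apply/andP; split.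
  by have [->|/S_bot h] := eqVneq s bot; [rewrite ht_bot|apply/ltW/h].
by have [->|/S_top h] := eqVneq s top; [rewrite ht_top|apply/ltW/h].
Qed.

Let divides M a := exists q r, [/\ bnd q (M / F), bnd r M, low r & a = q * f0 + r].

Let divides_add M a b : divides M a -> divides M b -> divides M (a + b).
Proof.
move=> [q [r [hq hr lr ->]]] [q' [r' [hq' hr' lr' ->]]].
exists (q + q'), (r + r'); split; [exact: bndD|exact: bndD| |by ring].
by move=> i hi; rewrite /= lr// lr'// addr0.
Qed.

Let divides_sum M (I : eqType) (s : seq I) (u : I -> A) : 0 < M ->
  (forall i, i \in s -> divides M (u i)) -> divides M (\sum_(i <- s) u i).
Proof.
move=> M0 h; rewrite big_seq; elim/big_ind: _ => //; last first.
  by move=> x y; apply: divides_add.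
exists 0, 0; split => //; last by rewrite mul0r addr0.
  by apply: bnd0; rewrite ltW// divr_gt0.
by apply: bnd0; apply: ltW.
Qed.

Let fS_neq0 s : s \in S -> f s != 0.
Proof.
case: df => _ _ _ _ [SF _] sS; apply/eqP => fs; have := F0.
by rewrite -(SF s sS) fs absv0 mul0r ltxx.
Qed.

(* Subtracting a multiple of f0 replaces a monomial by others, translates of the
   remaining terms of f0, without increasing the norm. With the term of largest
   height this lowers heights, with the term of least height it raises them; so
   every monomial is brought into the range of remainders. *)
Let divides_step M b s x : 0 < M -> x \in S -> absv b * rp s <= M ->
  (forall s', s' \in S -> s' != x ->
     forall b', absv b' * rp (s - x + s') <= M -> divides M (mono rho b' (s - x + s'))) ->
  divides M (mono rho b s).
Proof.
case: (df) => _ _ _ uS [SF _] M0 xS bM hs.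
have sx : absv (b / f x) * rp (s - x) <= M / F.
  have fx : absv (f x) != 0.
    by apply/eqP => /absv_eq0/eqP; rewrite (negPf (fS_neq0 xS)).
  rewrite ler_pdivlMr// -(SF x xS) mulrACA -absvM divfK ?fS_neq0//.
  by rewrite -rpowD subrK.
pose q0 := mono rho (b / f x) (s - x).
have -> : mono rho b s = q0 * f0 +
    \sum_(s' <- [seq s' <- S | s' != x]) mono rho (- (b / f x * f s')) (s - x + s').
  rewrite /f0 /dominant_part mulr_sumr (bigD1_seq x)//= big_filter -addrA.
  rewrite -big_split big1 ?addr0 => [|s' _]; last first.
    rewrite monoM; apply: laurent_eq => i /=.
    by rewrite /mono_coef; case: ifP; rewrite ?subrr ?addr0.
  by rewrite monoM subrK divfK// fS_neq0.
apply: divides_add; last first.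
  apply: divides_sum => // s'; rewrite mem_filter => /andP[s'x s'S].
  apply: hs => //; rewrite absvN absvM rpowD mulrACA SF//.
  by rewrite -ler_pdivlMr.
exists q0, 0; split => //; last by rewrite addr0.
  by apply: bnd_mono => //; rewrite ltW// divr_gt0.
by apply: bnd0; apply: ltW.
Qed.

Let divides_high M (k : nat) b s : 0 < M -> absv b * rp s <= M ->
  0 <= ht s < d%:Z + k%:Z -> divides M (mono rho b s).
Proof.
move=> M0; elim: k b s => [|k IH] b s bM.
  rewrite addr0 => hs; exists 0, (mono rho b s); split => //; last by rewrite mul0r add0r.
  - by apply: bnd0; rewrite ltW// divr_gt0.
  - by apply: bnd_mono => //; apply: ltW.
  - by move=> i; rewrite monoE; case: eqP => // ->.
move=> /andP[s0 sk]; have [lt|ge] := ltP (ht s) (d%:Z + k%:Z).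
  by apply: IH => //; rewrite s0 lt.
apply: (divides_step M0 topS bM) => s' s'S s'top b' b'M; apply: IH => //.
have := S_range s'S; have := S_top s'S s'top.
rewrite heightD heightB ht_top; lia.
Qed.

Let divides_low M (k : nat) b s : 0 < M -> absv b * rp s <= M ->
  - k%:Z <= ht s < d%:Z -> divides M (mono rho b s).
Proof.
move=> M0; elim: k b s => [|k IH] b s bM.
  by rewrite oppr0 => hs; apply: (@divides_high M 0); rewrite ?addr0.
move=> /andP[s0 sk]; have [lt|ge] := leP (- k%:Z) (ht s).
  by apply: IH => //; rewrite lt sk.
apply: (divides_step M0 botS bM) => s' s'S s'bot b' b'M; apply: IH => //.
have := S_range s'S; have := S_bot s'S s'bot.
rewrite heightD heightB ht_bot; lia.
Qed.

Let divides_mono M b s : 0 < M -> absv b * rp s <= M -> divides M (mono rho b s).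
Proof.
move=> M0 bM; have [lt|ge] := ltP (ht s) d%:Z.
  by apply: (@divides_low M `|ht s|%N) => //; lia.
by apply: (@divides_high M `|ht s|.+1%N) => //; lia.
Qed.

(** Finite sums of monomials are divided exactly by the dominant part of f; the
    remaining terms of f and of the dividend are absorbed by successive
    approximation. *)
Lemma laurent_division a M : 0 < M -> bnd a M -> exists q r,
  [/\ bnd q (M / F), bnd r M, low r & a = q * f + r].
Proof.
case: (df) => _ e0 e1 _ _; apply: (successive_division F0 e0 e1 (dominant_bnd df)).
move=> {}a {}M M0 aM; have [|s us hs] := truncate a (e := M * eps).
  by rewrite mulr_gt0.
have [|q [r [hq hr lr E]]] :=
  @divides_sum M _ s (fun i => mono rho (a i) i) M0.
  by move=> i _; apply: divides_mono.
exists q, r; split => //.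
have -> : a - (q * f + r) = (a - \sum_(i <- s) mono rho (a i) i) - q * (f - f0).
  by rewrite E; ring.
apply: bndB => //; have -> : M * eps = (M / F) * (F * eps).
  by rewrite mulrA divfK// gt_eqF.
by apply: bndM (dominant_part_bnd df) => //; rewrite ?divr_gt0 ?mulr_gt0.
Qed.

(** If q is nonzero, take its dominant exponents y and z of largest and least
    height. The product q f has nonzero coefficients at y + top and at z + bot;
    since it is minus a remainder, their heights lie between 0 and d - 1, which
    puts y below z. *)
Lemma laurent_division_uniq q r : low r -> q * f + r = 0 -> q = 0.
Proof.
move=> lr E; apply/eqP/negPn/negP => q0.
have [T [N [del [y0 [dq y0T]]]]] := dominant_exists q0.
have inrange i : (q * f) i != 0 -> 0 <= ht i < d%:Z.
  move=> h; apply/negPn/negP => hi; case/eqP: h.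
  have -> : q * f = - r by apply/eqP; rewrite -subr_eq0 opprK E.
  by rewrite /= lr ?oppr0// => h; rewrite h in hi.
have [y yT hy] := seq_max ht y0T.
have [z zT hz] := seq_max (fun i => - ht i) y0T.
have /inrange : (q * f) (y + top) != 0.
  apply: (coefM_extremal df dq) => // s sS stop; apply/negP => /hy.
  have := S_top sS stop; rewrite heightB heightD ht_top; lia.
have /inrange : (q * f) (z + bot) != 0.
  apply: (coefM_extremal df dq) => // s sS sbot; apply/negP => /hz.
  have := S_bot sS sbot; rewrite heightB heightD ht_bot; lia.
by have := hy z zT; rewrite !heightD ht_top ht_bot; lia.
Qed.
End Division.

(** * Weierstrass preparation and conclusion *)

Section Preparation.
Context {R : realType} {K : completeNonarchFieldType R} {n : nat}.
Variables (rho : 'I_n.+1 -> {posnum R}).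
Notation A := (laurent K rho).

(** Division by f of the non-dominant part of f, with the sign changed, gives a
    quotient q of norm at most [eps] and a remainder r such that (1 + q) f is the
    dominant part minus r: a polynomial in the distinguished variable, monic
    because its only dominant term of height d is the d-th power of that
    variable. *)
Lemma preparable_normalized (c : 'I_n -> int) (f : A) S F eps d bot :
  dominant f S F eps -> expon c 0 d%:Z \in S -> bot \in S ->
  f (expon c 0 d%:Z) = 1 -> height c bot = 0 ->
  (forall s, s \in S -> s != expon c 0 d%:Z -> height c s < d%:Z) ->
  (forall s, s \in S -> s != bot -> 0 < height c s) ->
  projfree (laurent K (slice_radius rho c)) -> weierstrass_preparable f.
Proof.
set top := expon c 0 d%:Z => df topS botS ftop hbot Stop Sbot Bfree.
have htop : height c top = d%:Z by rewrite height_expon.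
have [F0 e0 e1 uS [SF SnF]] := df.
have division := laurent_division df topS botS htop hbot Stop Sbot.
have uniqueness := laurent_division_uniq df topS botS htop hbot Stop Sbot.
have [|q [r [hq _ lr E]]] := division (- (f - dominant_part f S)) (F * eps) _
    (bndN (dominant_part_bnd df)).
  by rewrite mulr_gt0.
rewrite [F * eps]mulrC mulfK ?gt_eqF// in hq.
have [v uv] := bnd_unit e0 e1 hq; set u := 1 + q in uv.
pose W := f * u.
have WE : W = dominant_part f S - r.
  have -> : W = f + (q * f + r) - r by rewrite /W /u; ring.
  by rewrite -E; ring.
have WcoefE i : W i = (if i \in S then f i else 0) - r i by rewrite WE -dominant_partE.
pose w := slice_poly c d.+1 W.
have evw : ev (@embed R K n rho c : {rmorphism _ -> _}) (tvar rho c) w = W.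
  apply: ev_slice_poly => i hi; rewrite WcoefE lr ?subr0; last by lia.
  case: ifP => // iS; exfalso; apply: hi.
  have h1 : 0 <= height c i.
    by have [->|/Sbot/ltW->//] := eqVneq i bot; rewrite hbot.
  have h2 : height c i <= d%:Z.
    by have [->|/Stop/ltW->//] := eqVneq i top; rewrite htop.
  lia.
have wd : w`_d = 1.
  rewrite coef_poly ltnSn; apply: laurent_eq => j.
  change (W (expon c j d%:Z) = (j == 0)%:R).
  rewrite WcoefE lr ?height_expon ?ltxx ?andbF ?subr0//.
  have [->|j0] := eqVneq j 0; first by rewrite topS.
  rewrite ifF//; apply/negP => iS.
  have itop : expon c j d%:Z != top.
    by apply: contra j0 => /eqP/(congr1 tailexp); rewrite !tailexp_expon => ->.
  by have := Stop _ iS itop; rewrite height_expon ltxx.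
have sw : size w = d.+1.
  apply/eqP; rewrite eqn_leq size_poly /=; apply: contraT; rewrite -ltnNge ltnS.
  by move=> h; move: wd => /eqP; rewrite nth_default// eq_sym oner_eq0.
exists (laurent K (slice_radius rho c)), (@embed R K n rho c : {rmorphism _ -> _}),
  (tvar rho c), w, u, v; split => //.
split.
- by rewrite monicE lead_coefE sw /= wd.
- exact: ev_inj.
- move=> a; have [M M0 aM] := bnd_exists a.
  have [q' [r' [_ _ lr' ->]]] := division a M M0 aM.
  exists (q' * v), (slice_poly c d r'); rewrite sw ltnS size_poly evw.
  rewrite ev_slice_poly//; split => //; congr (_ + _).
  have -> : q' * v * W = q' * f * (u * v) by rewrite /W; ring.
  by rewrite uv mulr1.
- move=> q' p sp; rewrite evw /W [f * u]mulrC mulrA => Eq.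
  have q'u : q' * u = 0.
    apply: uniqueness Eq => i hi; rewrite coef_ev; case: ifP => // h0.
    rewrite nth_default//; move: sp; rewrite sw ltnS => /leq_trans; apply.
    by have /negP := hi; rewrite h0 /= -leNgt; lia.
  by rewrite -[q']mulr1 -uv mulrA q'u mul0r.
Qed.

(** With c_b = D^(b+1), the height of an exponent is the value at D of the
    polynomial with that exponent as coefficients; D avoids the finitely many
    roots of the differences. *)
Lemma separating_height (S : seq (multiexp n.+1)) : exists c : 'I_n -> int,
  {in S &, injective (height c)}.
Proof.
pose P (i : multiexp n.+1) : {poly int} := \poly_(a < n.+1) i (inord a).
have Pinj i i' : P i = P i' -> i = i'.
  move=> PP; apply/ffunP => a; have := congr1 (fun p : {poly int} => p`_a) PP.
  by rewrite !coef_poly ltn_ord inord_val.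
pose Q := \prod_(x <- S) \prod_(y <- S | P x != P y) (P x - P y).
have Q0 : Q != 0.
  rewrite prodf_seq_neq0; apply/allP => x _ /=.
  by rewrite prodf_seq_neq0; apply/allP => y _; apply/implyP; rewrite subr_eq0.
have [D QD] : exists D : int, Q.[D] != 0.
  apply: contrapT => nD.
  pose rs := [seq Posz k | k <- iota 0 (size Q)].
  have urs : uniq rs by rewrite map_inj_uniq ?iota_uniq// => x y [].
  have rrs : all (root Q) rs.
    by apply/allP => x _; apply/negPn/negP => h; apply: nD; exists x.
  by have := max_poly_roots Q0 rrs urs; rewrite size_map size_iota ltnn.
exists (fun b => D ^+ b.+1).
have heightE i : height (fun b : 'I_n => D ^+ b.+1) i = (P i).[D].
  rewrite horner_poly big_ord_recl /= expr0 mulr1 /height; congr (i _ + _).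
    by apply: val_inj; rewrite /= inordK.
  apply: eq_bigr => b _; rewrite mulrC; congr (i _ * _).
  by apply: val_inj; rewrite /= inordK// ltnS.
move=> x y xS yS; rewrite !heightE => hxy; apply: Pinj; apply/eqP.
apply: contraT => Pxy; case/negP: QD.
rewrite horner_prod (big_rem x)//= horner_prod (big_rem y)//= Pxy.
by rewrite hornerD hornerN hxy subrr !mul0r.
Qed.

(** A height separating the dominant exponents has a unique largest and a unique
    least value among them; multiplying by a monomial puts the least at height 0
    and makes the term of largest height a power of the distinguished variable. *)
Lemma laurent_preparable (f : A) :
  (forall rho' : 'I_n -> {posnum R}, projfree (laurent K rho')) ->
  f != 0 -> weierstrass_preparable f.
Proof.
move=> Bfree f0; have [S [F [eps [s0 [df s0S]]]]] := dominant_exists f0.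
have [c cinj] := separating_height S.
have [top topS htop] := seq_max (height c) s0S.
have [bot botS hbot] := seq_max (fun i => - height c i) s0S.
have [F0 e0 e1 uS [SF SnF]] := df.
have ft0 : f top != 0.
  by apply/eqP => ft; have := F0; rewrite -(SF top topS) ft absv0 mul0r ltxx.
pose d := `|height c top - height c bot|%N.
have dE : d%:Z = height c top - height c bot.
  by rewrite /d gez0_abs// subr_ge0; have := htop _ botS.
pose sh := expon c 0 d%:Z - top.
pose m := mono rho (f top)^-1 sh.
have gE i : (m * f) i = (f top)^-1 * f (i - sh) by rewrite coef_monoM.
have hsh s : height c (s + sh) = height c s - height c bot.
  by rewrite heightD heightB height_expon dE; ring.
have fac0 : 0 < absv (f top)^-1 * rpow rho sh.
  rewrite mulr_gt0 ?rpow_gt0// lt_def absv_ge0 andbT.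
  by apply/eqP => /absv_eq0/eqP; rewrite invr_eq0 (negPf ft0).
have topE : top + sh = expon c 0 d%:Z by rewrite /sh addrC subrK.
have wg i : absv ((m * f) i) * rpow rho i =
    absv (f top)^-1 * rpow rho sh * (absv (f (i - sh)) * rpow rho (i - sh)).
  rewrite gE absvM mulrACA; congr (_ * _); rewrite -rpowD.
  by rewrite addrC subrK.
have memS i : (i \in [seq s + sh | s <- S]) = (i - sh \in S).
  by rewrite -{1}[i](subrK sh); exact: (mem_map (addIr sh)).
have dg : dominant (m * f) [seq s + sh | s <- S]
    (absv (f top)^-1 * rpow rho sh * F) eps.
  split => //; first exact: mulr_gt0.
    by rewrite map_inj_uniq// => x y /addIr.
  split=> i; rewrite memS wg => h; first by rewrite SF.
  by rewrite -[leRHS]mulrA ler_pM2l// SnF.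
have [|||||||B [iota [t [w [u [v [hB hw uv gu]]]]]]] :=
    @preparable_normalized c (m * f) _ _ _ d (bot + sh) dg.
- by rewrite -topE memS addrK.
- by rewrite memS addrK.
- by rewrite gE -topE addrK mulVf.
- by rewrite hsh subrr.
- move=> s; rewrite memS => sS stop.
  rewrite -[s](subrK sh) hsh dE ltrD2r lt_neqAle htop// andbT.
  apply: contra stop => /eqP/(cinj _ _ sS topS) h.
  by rewrite -topE -h subrK.
- move=> s; rewrite memS => sS sbot.
  rewrite -[s](subrK sh) hsh subr_gt0 lt_neqAle -lerN2 hbot// andbT.
  apply: contra sbot => /eqP h.
  by rewrite (cinj _ _ botS sS h) subrK.
- exact: Bfree.
exists B, iota, t, w, (m * u), (v * mono rho (f top) (- sh)); split => //.
  have -> : m * u * (v * mono rho (f top) (- sh)) =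
      (u * v) * (m * mono rho (f top) (- sh)) by ring.
  by rewrite uv mul1r monoM subrr mulVf// mono1.
by rewrite -gu; ring.
Qed.
End Preparation.

Lemma projfree_inv (A : comNzRingType) :
  (forall x : A, x != 0 -> exists y, x * y = 1) -> projfree A.
Proof.
move=> Ainv n E EE.
have Aint (x y : A) : x * y = 0 -> (x == 0) || (y == 0).
  move=> xy; have [//|/Ainv[z xz]] := eqVneq x 0.
  by rewrite -[y]mul1r -xz mulrAC xy mul0r eqxx.
have [r [f [X [Y [/Ainv[u fu] XY YX]]]]] := idempotent_generic Aint EE.
exists r, (u *: Y), X; split.
  by rewrite -scalemxAl YX scalerA mulrC fu scale1r.
by rewrite -scalemxAr XY scale_scalar_mx mulrC fu.
Qed.

Lemma laurent0_inv (R : realType) (K : completeNonarchFieldType R)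
    (rho : 'I_0 -> {posnum R}) (f : laurent K rho) :
  f != 0 -> exists g, f * g = 1.
Proof.
have exp0 (i : multiexp 0) : i = 0 by apply/ffunP => -[].
move=> f0; have fE : f = mono rho (f 0) 0.
  by apply: laurent_eq => i; rewrite monoE (exp0 i) eqxx.
exists (mono rho (f 0)^-1 0); rewrite {1}fE monoM addr0 divff ?mono1//.
apply: contra f0 => /eqP c0; rewrite fE c0; apply/eqP/laurent_eq => i.
by rewrite monoE; case: ifP.
Qed.

Theorem laurent_projfree (R : realType) (K : completeNonarchFieldType R) n
    (rho : 'I_n -> {posnum R}) : projfree (laurent K rho).
Proof.
elim: n rho => [|n IH] rho; first exact/projfree_inv/laurent0_inv.
by apply: weierstrass_projfree => f; apply: laurent_preparable.
Qed.

(** A finite projective module is the image of an idempotent matrix, the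
    composite of a surjection from a free module with one of its sections. *)
Lemma projfree_module (A : comNzRingType) (P : lmodType A) :
  projfree A -> finite_module P -> projective_module P -> free_module P.
Proof.
move=> Afree [d [e egen]] Pproj.
pose g0 (v : 'rV[A]_d) : P := \sum_k v 0 k *: e k.
have g0lin : linear g0.
  move=> a u v; rewrite /g0 scaler_sumr -big_split; apply: eq_bigr => k _.
  by rewrite !mxE scalerDl scalerA.
pose g : {linear 'rV[A]_d -> P} := HB.pack g0 (GRing.isLinear.Build A _ _ _ g0 g0lin).
have gsurj y : exists x, g x = y.
  have [c ->] := egen y; exists (\row_k c k); apply: eq_bigr => k _.
  by rewrite mxE.
have [h hK] := Pproj _ _ g (idfun : {linear P -> P}) gsurj.
pose E := lin1_mx (h \o g).
have EE u : u *m E = h (g u) by rewrite mul_rV_lin1.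
have Eidem : E *m E = E.
  by apply/row_matrixP => i; rewrite !rowE mulmxA !EE hK.
have [r [X [Y [XY YX]]]] := Afree _ _ Eidem.
have gY (s : nat) (i : 'I_s -> 'I_r) (c : 'I_s -> A) :
    \sum_k c k *: g (row (i k) Y) = g ((\sum_k c k *: delta_mx 0 (i k)) *m Y).
  rewrite mulmx_suml linear_sum; apply: eq_bigr => k _.
  by rewrite -scalemxAl linearZ rowE.
exists 'I_r, (fun k => g (row k Y)); split=> [x|s i c iinj].
  exists r, id, (fun k => (h x *m X) 0 k).
  by rewrite gY -row_sum_delta -mulmxA XY EE !hK.
rewrite gY => /(congr1 h); rewrite linear0 -EE -XY mulmxA -(mulmxA _ Y) YX mulmx1.
move=> /(congr1 (mulmxr X)) /=; rewrite mul0mx -mulmxA YX mulmx1 => v0 k.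
have := congr1 (fun v : 'rV[A]_r => v 0 (i k)) v0.
rewrite /= summxE mxE (bigD1 k)//= big1 => [|k' kk'].
  by rewrite !mxE !eqxx mulr1 addr0.
by rewrite !mxE eqxx (inj_eq iinj) eq_sym (negPf kk') mulr0.
Qed.

Theorem theorem1p16 (R : realType) (p : nat) (K : completeNonarchFieldType R)
    (n : nat) (rho : 'I_n -> {posnum R})
    (p_prime : prime p)
    (K_char0 : [pchar K] =i pred0)
    (absv_p : absv (p%:R : K) = p%:R^-1)
    (n_gt0 : (0 < n)%N)
    (rho_val : forall k : 'I_n, sqrt_value_group K (rho k)%:num)
    (P : lmodType (laurent K rho)) :
  finite_module P -> projective_module P -> free_module P.
Proof.
exact/projfree_module/laurent_projfree.
Qed.
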